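(* Let $T>0$, let $\gamma\in\mathcal{C}^1_T(\mathbb{R})$, and let $\Delta_\gamma$ be the discriminant of the Riccati equation $$x'=x^2+\gamma(t).$$ If $\Delta_\gamma>0$, then this equation has exactly two limit cycles and both are hyperbolic; if $\Delta_\gamma=0$, it has a unique limit cycle, which is semi-stable and double; and if $\Delta_\gamma<0$, it has no limit cycles. Moreover, $$\underline{\mu}[\gamma](p)-\overline{\gamma}\le\Delta_\gamma\le\overline{\mu}[\gamma](q)-\overline{\gamma}$$ for every $p\in\mathcal{C}^1_T(\mathbb{R})$ and every $q\in\mathcal{C}^1_{T,0}(\mathbb{R})$.
   Context: $\mathcal{C}^1_T(\mathbb{R})$ denotes the space of $T$-periodic $\mathcal{C}^1$ real functions on $\mathbb{R}$, and $\mathcal{C}^1_{T,0}(\mathbb{R})$ the subspace of those with zero average over $[0,T]$. For $\gamma\in\mathcal{C}^1_T(\mathbb{R})$ put $\overline{\gamma}:=\frac1T\int_0^T\gamma(t)\,dt$ and $\widehat{\gamma}(t):=\gamma(t)-\overline{\gamma}$, and define $$\underline{\mu}[\gamma](p):=-\max_{t\in[0,T]}\{p(t)^2+\widehat{\gamma}(t)-p'(t)\},\qquad p\in\mathcal{C}^1_T(\mathbb{R}),$$ $$\overline{\mu}[\gamma](p):=\Big(\int_0^T e^{-2\int_0^t p(s)\,ds}\,dt\Big)^{-1}\int_0^T e^{-2\int_0^t p(s)\,ds}\big(p(t)^2-\widehat{\gamma}(t)\big)\,dt,\qquad p\in\mathcal{C}^1_{T,0}(\mathbb{R}).$$ The number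 $\gamma^*:=\max\{\underline{\mu}[\gamma](p):p\in\mathcal{C}^1_T(\mathbb{R})\}$ exists and equals $\min\{\overline{\mu}[\gamma](p):p\in\mathcal{C}^1_{T,0}(\mathbb{R})\}$. The discriminant of $x'=x^2+\gamma(t)$ is $\Delta_\gamma:=\gamma^*-\overline{\gamma}$. For a $T$-periodic equation $x'=f(t,x)$, a limit cycle is an isolated $T$-periodic solution. The displacement map sends an initial value $x_0$ at $t=0$ to $x(T;x_0)-x_0$, where $x(\cdot;x_0)$ is the solution with $x(0;x_0)=x_0$ (where defined up to time $T$). A limit cycle $\phi$ is hyperbolic if $\phi(0)$ is a simple zero of the displacement map, equivalently $\int_0^T\frac{\partial f}{\partial x}(t,\phi(t))\,dt\neq0$. It is double if $\phi(0)$ is a zero of multiplicity exactly $2$ of the displacement map. It is semi-stable if it attracts nearby solutions from one side and repels them from the other. *)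

(* Defs.v *)
From Stdlib Require Import Reals.
From Coquelicot Require Import Coquelicot.
Open Scope R_scope.

Definition is_maximum {A : Type} (P : A -> Prop) (F : A -> R) (m : R) : Prop :=
  (exists a, P a /\ F a = m) /\ (forall a, P a -> F a <= m).

(* [iota] is Coquelicot's definite description: an arbitrary real if there is
   no maximum. *)
Definition maximum {A : Type} (P : A -> Prop) (F : A -> R) : R :=
  iota (is_maximum P F).

Lemma maximum_eq {A : Type} (P : A -> Prop) (F : A -> R) (m : R) :
  is_maximum P F m -> maximum P F = m.
Proof.
  intros Hm.
  assert (U : forall m', is_maximum P F m' -> m' = m).
  { intros m' [[a' [Pa' <-]] H']; destruct Hm as [[a [Pa <-]] H].
    apply Rle_antisym; auto. }
  apply U, (iota_correct (V := R_CompleteNormedModule) (is_maximum P F)).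
  exists m; split; [exact Hm | intros m' H'; symmetry; now apply U].
Qed.

Definition periodic (T : R) (g : R -> R) : Prop := forall t, g (t + T) = g t.

Definition C1T (T : R) (g : R -> R) : Prop :=
  periodic T g /\ forall t, ex_derive g t /\ continuous (Derive g) t.

Definition average (T : R) (g : R -> R) : R := / T * RInt g 0 T.

Definition C1T0 (T : R) (g : R -> R) : Prop := C1T T g /\ average T g = 0.

Definition centered (T : R) (g : R -> R) (t : R) : R := g t - average T g.

Definition mu_lower (T : R) (gamma p : R -> R) : R :=
  - maximum (fun t => 0 <= t <= T)
            (fun t => p t ^ 2 + centered T gamma t - Derive p t).

Definition mu_upper (T : R) (gamma p : R -> R) : R :=
  / RInt (fun t => exp (-2 * RInt p 0 t)) 0 T
  * RInt (fun t => exp (-2 * RInt p 0 t) * (p t ^ 2 - centered T gamma t)) 0 T.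

Definition gamma_star (T : R) (gamma : R -> R) : R :=
  maximum (C1T T) (mu_lower T gamma).

Definition discriminant (T : R) (gamma : R -> R) : R :=
  gamma_star T gamma - average T gamma.

Definition riccati (gamma : R -> R) (t x : R) : R := x ^ 2 + gamma t.

Definition solution_on (D : R -> Prop) (f : R -> R -> R) (x : R -> R) : Prop :=
  forall t, D t -> is_derive x t (f t (x t)).

Definition periodic_solution (T : R) (f : R -> R -> R) (x : R -> R) : Prop :=
  solution_on (fun _ => True) f x /\ periodic T x.

Definition limit_cycle (T : R) (f : R -> R -> R) (phi : R -> R) : Prop :=
  periodic_solution T f phi /\
  exists eps, 0 < eps /\
    forall x, periodic_solution T f x ->
      (forall t, Rabs (x t - phi t) < eps) -> x = phi.

(* The displacement map is a partial function, given here by its graph; the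
   right-hand sides [f] of interest are locally Lipschitz in the space variable,
   so that [d] is unique. *)
Definition is_displacement (T : R) (f : R -> R -> R) (x0 d : R) : Prop :=
  exists x, solution_on (fun t => 0 <= t <= T) f x /\ x 0 = x0 /\ x T - x0 = d.

Definition displacement (T : R) (f : R -> R -> R) (x0 : R) : R :=
  iota (is_displacement T f x0).

Definition zero_of_multiplicity (h : R -> R) (m : nat) (x0 : R) : Prop :=
  locally x0 (fun y => forall k, (k <= m)%nat -> ex_derive_n h k y) /\
  (forall k, (k < m)%nat -> Derive_n h k x0 = 0) /\
  Derive_n h m x0 <> 0.

(* The first clause makes the values of [displacement] meaningful near
   [phi 0]. *)
Definition cycle_of_multiplicity (T : R) (f : R -> R -> R) (m : nat)
    (phi : R -> R) : Prop :=
  locally (phi 0) (fun y => exists d, is_displacement T f y d) /\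
  zero_of_multiplicity (displacement T f) m (phi 0).

Definition hyperbolic (T : R) (f : R -> R -> R) (phi : R -> R) : Prop :=
  cycle_of_multiplicity T f 1 phi.

Definition double_cycle (T : R) (f : R -> R -> R) (phi : R -> R) : Prop :=
  cycle_of_multiplicity T f 2 phi.

(* [s] is 1 for the solutions above [phi] and -1 for those below. *)
Definition attracts (f : R -> R -> R) (phi : R -> R) (s : R) : Prop :=
  exists delta, 0 < delta /\
    forall h, 0 < h < delta ->
      exists x, solution_on (fun t => 0 <= t) f x /\ x 0 = phi 0 + s * h /\
        is_lim (fun t => x t - phi t) p_infty 0.

(* Repulsion is attraction in reversed time. *)
Definition repels (f : R -> R -> R) (phi : R -> R) (s : R) : Prop :=
  exists delta, 0 < delta /\
    forall h, 0 < h < delta ->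
      exists x, solution_on (fun t => t <= 0) f x /\ x 0 = phi 0 + s * h /\
        is_lim (fun t => x t - phi t) m_infty 0.

Definition semi_stable (f : R -> R -> R) (phi : R -> R) : Prop :=
  (attracts f phi 1 /\ repels f phi (-1)) \/
  (attracts f phi (-1) /\ repels f phi 1).

(* Main.v *)
Require Import Defs.
From Stdlib Require Import Reals Lra Lia ZArith FunctionalExtensionality Classical.
From Coquelicot Require Import Coquelicot.
Open Scope R_scope.

(** There is a critical parameter [c] for which [x' = x ^ 2 + gamma + c] has a periodic solution
    [phi] of zero mean ([critical_parameter]), and everything follows from this pair.

    Put [e = exp (-2 int phi)], which is periodic. If [p' >= p ^ 2 + gamma + m] with [p] periodic,
    the derivative of [e (p - phi)] is at least [e ((p - phi) ^ 2 + m - c)], so [m <= c]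
    ([subsolution_level]). Hence [mu_lower] is at most [average gamma + c], with equality at
    [phi]: the maximum [gamma_star] is attained and the discriminant is [c]
    ([discriminant_critical]). The bound by [mu_upper] comes in the same way from
    completing the square in [e (q - phi) ^ 2], with [q] in the exponent ([mu_upper_ge]).

    A periodic solution of [x' = x ^ 2 + gamma] is a subsolution at level [0], so there is none
    when [c < 0]. When [c > 0], [phi] is a strict subsolution and produces a periodic solution
    ([periodic_solution_of_subsolution]); no periodic solution [x] has zero mean, since
    [subsolution_level] applied to [x] and [phi] would give [c <= 0].

    Once one periodic solution [x] is known, subtracting it leaves a Bernoulli equation that is
    solved explicitly ([neighbour]). With [M = exp (2 int_0^T x)] and
    [S = int_0^T exp (2 int_0^t x) dt > 0], the displacement at [x 0 + y] is
    [M y / (1 - S y) - y]. If [M <> 1] it has exactly one more zero, [(1 - M) / S], and both are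
    simple; if [M = 1] it has the only zero [0], which is double, and the formula shows that
    solutions starting below [x] converge to it in the future and those starting above it
    in the past.

    The critical pair is found from the displacement map of the equation truncated at a level
    that no periodic solution reaches ([excursion_bound]). The truncated equation has
    global solutions ([picard_existence]), whose displacement is Lipschitz in the initial
    value and in the parameter. At the largest parameter for which it vanishes somewhere,
    its minimum is [0]; by the formula above, the displacement would change sign if the
    corresponding periodic solution had a nonzero mean. *)

(** * Mean value inequalities and elementary calculus *)

Lemma mean_value (f df : R -> R) (a b : R) :
  a <= b -> (forall t, a <= t <= b -> is_derive f t (df t)) ->
  exists c, a <= c <= b /\ f b - f a = df c * (b - a).
Proof.
  intros hab hf.
  destruct (MVT_gen f a b df) as [c [hc e]].
  - rewrite Rmin_left, Rmax_right by lra. intros t ht. apply hf. lra.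
  - rewrite Rmin_left, Rmax_right by lra. intros t ht.
    apply continuity_pt_filterlim, (@ex_derive_continuous R_AbsRing R_NormedModule).
    exists (df t). now apply hf.
  - rewrite Rmin_left, Rmax_right in hc by lra. now exists c.
Qed.

Lemma nondecreasing (f df : R -> R) (a b : R) :
  a <= b -> (forall t, a <= t <= b -> is_derive f t (df t)) ->
  (forall t, a <= t <= b -> 0 <= df t) -> f a <= f b.
Proof.
  intros hab hf pos. destruct (mean_value f df a b hab hf) as [c [hc e]].
  specialize (pos c hc). nra.
Qed.

Lemma constant_of_derive_0 (f : R -> R) :
  (forall t, is_derive f t 0) -> forall t, f t = f 0.
Proof.
  intros hf t. destruct (Rle_dec 0 t).
  - destruct (mean_value f (fun _ => 0) 0 t) as [c [hc e]]; auto. lra.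
  - destruct (mean_value f (fun _ => 0) t 0) as [c [hc e]]; auto; lra.
Qed.

Lemma is_derive_continuous (f : R -> R) (t l : R) : is_derive f t l -> continuous f t.
Proof.
  intros h. apply (@ex_derive_continuous R_AbsRing R_NormedModule). now exists l.
Qed.

Lemma is_derive_primitive (f : R -> R) :
  (forall t, continuous f t) -> forall t, is_derive (RInt f 0) t (f t).
Proof.
  intros hf t. apply (@is_derive_RInt R_NormedModule f (RInt f 0) 0).
  - apply filter_forall. intros s. apply (@RInt_correct R_CompleteNormedModule).
    apply (@ex_RInt_continuous R_CompleteNormedModule). auto.
  - apply hf.
Qed.

Lemma RInt_0_0 (f : R -> R) : RInt f 0 0 = 0.
Proof. apply (@RInt_point R_CompleteNormedModule). Qed.

Lemma is_derive_eq (f : R -> R) (t l l' : R) :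
  is_derive f t l -> l = l' -> is_derive f t l'.
Proof. now intros h <-. Qed.

Lemma is_derive_reflect (f : R -> R) (t l : R) :
  is_derive f (- t) l -> is_derive (fun s => f (- s)) t (- l).
Proof.
  intros h. replace (- l) with (scal (-1) l) by (unfold scal; simpl; unfold mult; simpl; ring).
  apply (is_derive_comp f Ropp t l (-1) h). auto_derive; auto.
Qed.

Lemma lipschitz_continuous (f : R -> R) (K : R) :
  0 <= K -> (forall x y, Rabs (f x - f y) <= K * Rabs (x - y)) ->
  forall x, continuous f x.
Proof.
  intros hK hf x. apply continuity_pt_filterlim. intros eps he.
  exists (eps / (K + 1)). split; [apply Rdiv_lt_0_compat; lra|].
  intros s [_ hs]. simpl in *. unfold R_dist in *.
  specialize (hf s x). apply (Rmult_lt_compat_r (K + 1)) in hs; [|lra].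
  replace (eps / (K + 1) * (K + 1)) with eps in hs by (field; lra).
  pose proof (Rabs_pos (s - x)). nra.
Qed.

Lemma continuous_square (f : R -> R) (t : R) :
  continuous f t -> continuous (fun s => f s ^ 2) t.
Proof.
  intros hf. apply (continuous_mult f (fun s => f s * 1)); auto.
  apply (continuous_mult f (fun _ => 1)); auto. apply continuous_const.
Qed.

Lemma periodic_end (T : R) (f : R -> R) : periodic T f -> f T = f 0.
Proof. intros hf. rewrite <- (hf 0). now rewrite Rplus_0_l. Qed.

(** * Comparison of solutions of differential inequalities *)

(** Unlike the positive part, its square is differentiable everywhere, which lets
    [comparison] be proved by differentiation alone. *)
Lemma is_derive_square_positive_part (x : R) :
  is_derive (fun y => Rmax y 0 ^ 2) x (2 * Rmax x 0).
Proof.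
  apply is_derive_Reals. intros eps he. exists (mkposreal eps he).
  intros h hn hh. simpl in hh.
  assert (hb : Rabs (Rmax (x + h) 0 ^ 2 - Rmax x 0 ^ 2 - 2 * Rmax x 0 * h) <= h * h).
  { apply Rabs_le. unfold Rmax. destruct (Rle_dec (x + h) 0), (Rle_dec x 0); nra. }
  replace ((Rmax (x + h) 0 ^ 2 - Rmax x 0 ^ 2) / h - 2 * Rmax x 0)
    with ((Rmax (x + h) 0 ^ 2 - Rmax x 0 ^ 2 - 2 * Rmax x 0 * h) / h)
    by (field; exact hn).
  unfold Rdiv. rewrite Rabs_mult, Rabs_inv.
  assert (0 < Rabs h) by now apply Rabs_pos_lt.
  apply Rle_lt_trans with (h * h * / Rabs h).
  - apply Rmult_le_compat_r; [left; now apply Rinv_0_lt_compat | exact hb].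
  - replace (h * h) with (Rabs h * Rabs h) by (rewrite <- Rabs_mult; apply Rabs_pos_eq; nra).
    replace (Rabs h * Rabs h * / Rabs h) with (Rabs h) by (field; lra). exact hh.
Qed.

(** The weighted square [exp (-2 K t) * Rmax (z t) 0 ^ 2] cannot increase, and it vanishes
    at [0]. Asking the inequality only where [z] is positive is what allows a one-sided
    Lipschitz estimate, or an absolute value, to be used in it. *)
Lemma comparison (K T : R) (z dz : R -> R) :
  (forall t, 0 <= t <= T -> is_derive z t (dz t)) ->
  (forall t, 0 <= t <= T -> 0 < z t -> dz t <= K * z t) ->
  z 0 <= 0 -> forall t, 0 <= t <= T -> z t <= 0.
Proof.
  intros hz hle h0 t ht.
  set (w := fun s => - (exp (-2 * K * s) * Rmax (z s) 0 ^ 2)).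
  assert (hw : w 0 <= w t).
  { apply (nondecreasing w
      (fun s => 2 * exp (-2 * K * s) * Rmax (z s) 0 * (K * Rmax (z s) 0 - dz s))).
    - lra.
    - intros s hs. unfold w.
      assert (d1 : is_derive (fun s => Rmax (z s) 0 ^ 2) s (dz s * (2 * Rmax (z s) 0))).
      { apply (is_derive_comp (fun y => Rmax y 0 ^ 2) z s).
        - apply is_derive_square_positive_part.
        - apply hz. lra. }
      assert (d2 : is_derive (fun s => exp (-2 * K * s)) s (-2 * K * exp (-2 * K * s))).
      { auto_derive; auto. ring. }
      eapply is_derive_eq; [exact (is_derive_opp _ _ _ (is_derive_mult _ _ _ _ _ d2 d1 Rmult_comm))|].
      unfold opp, plus, mult; simpl. ring.
    - intros s hs. pose proof (exp_pos (-2 * K * s)).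
      unfold Rmax. destruct (Rle_dec (z s) 0); [nra|].
      assert (dz s <= K * z s) by (apply hle; lra).
      apply Rmult_le_pos; [nra | lra]. }
  unfold w in hw. pose proof (exp_pos (-2 * K * t)).
  rewrite (Rmax_right (z 0) 0) in hw by lra.
  destruct (Rle_dec (z t) 0); auto. rewrite Rmax_left in hw by lra.
  assert (0 < z t ^ 2) by (apply pow_lt; lra). nra.
Qed.

Lemma one_le_exp (x : R) : 0 <= x -> 1 <= exp x.
Proof. intros h. pose proof (exp_ineq1_le x). lra. Qed.

(** The right-hand side is a supersolution of [z' = K z + b]; it is simpler than the exact
    solution, which would divide by [K]. *)
Lemma gronwall_le (K a b T : R) (z dz : R -> R) :
  0 <= K -> 0 <= a -> 0 <= b ->
  (forall t, 0 <= t <= T -> is_derive z t (dz t)) ->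
  (forall t, 0 <= t <= T -> dz t <= K * Rabs (z t) + b) ->
  z 0 <= a -> forall t, 0 <= t <= T -> z t <= (a + b * t) * exp (K * t).
Proof.
  intros hK ha hb hz hle h0 t ht. apply Rminus_le.
  apply (comparison K T (fun t => z t - (a + b * t) * exp (K * t))
           (fun t => dz t - (b * exp (K * t) + (a + b * t) * (K * exp (K * t))))); auto.
  - intros s hs. apply (is_derive_minus z (fun t => (a + b * t) * exp (K * t))).
    + now apply hz.
    + auto_derive; auto. ring.
  - intros s hs pos. specialize (hle s hs).
    assert (1 <= exp (K * s)).
    { apply one_le_exp. nra. }
    assert (0 <= (a + b * s) * exp (K * s)) by (apply Rmult_le_pos; nra).
    rewrite Rabs_pos_eq in hle by lra. nra.
  - rewrite !Rmult_0_r, exp_0. lra.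
Qed.

Lemma gronwall (K a b T : R) (z dz : R -> R) :
  0 <= K -> 0 <= a -> 0 <= b ->
  (forall t, 0 <= t <= T -> is_derive z t (dz t)) ->
  (forall t, 0 <= t <= T -> Rabs (dz t) <= K * Rabs (z t) + b) ->
  Rabs (z 0) <= a -> forall t, 0 <= t <= T -> Rabs (z t) <= (a + b * t) * exp (K * t).
Proof.
  intros hK ha hb hz hle h0 t ht. apply Rabs_le_between in h0. apply Rabs_le. split.
  - assert (- z t <= (a + b * t) * exp (K * t)); [|lra].
    apply (gronwall_le K a b T (fun s => - z s) (fun s => - dz s)); auto.
    + intros s hs. apply (is_derive_opp z). auto.
    + intros s hs. rewrite Rabs_Ropp. specialize (hle s hs).
      apply Rabs_le_between in hle. lra.
    + lra.
  - apply (gronwall_le K a b T z dz); auto.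
    + intros s hs. specialize (hle s hs). apply Rabs_le_between in hle. lra.
    + lra.
Qed.

Lemma vanishes_of_linear_growth (K T : R) (z dz : R -> R) :
  0 <= K -> (forall t, 0 <= t <= T -> is_derive z t (dz t)) ->
  (forall t, 0 <= t <= T -> Rabs (dz t) <= K * Rabs (z t)) ->
  z 0 = 0 -> forall t, 0 <= t <= T -> z t = 0.
Proof.
  intros hK hz hle h0 t ht.
  assert (h : Rabs (z t) <= (0 + 0 * t) * exp (K * t)).
  { apply (gronwall K 0 0 T z dz); auto; try lra.
    - intros s hs. specialize (hle s hs). lra.
    - rewrite h0, Rabs_R0. lra. }
  pose proof (Rabs_pos (z t)). apply Rabs_eq_0. lra.
Qed.

(** * Initial value problems with a bounded Lipschitz field *)

Definition lipschitz (K : R) (f : R -> R -> R) : Prop :=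
  forall t x y, Rabs (f t x - f t y) <= K * Rabs (x - y).

Lemma solution_unique (K T : R) (f : R -> R -> R) (x y : R -> R) :
  0 <= K -> lipschitz K f ->
  solution_on (fun t => 0 <= t <= T) f x -> solution_on (fun t => 0 <= t <= T) f y ->
  x 0 = y 0 -> forall t, 0 <= t <= T -> x t = y t.
Proof.
  intros hK hf hx hy e t ht. apply Rminus_diag_uniq.
  apply (vanishes_of_linear_growth K T (fun t => x t - y t) (fun t => f t (x t) - f t (y t)));
    auto; [|lra].
  intros s hs. apply (is_derive_minus x y); auto.
Qed.

Lemma solution_unique_global (K : R) (f : R -> R -> R) (x y : R -> R) :
  0 <= K -> lipschitz K f ->
  solution_on (fun _ => True) f x -> solution_on (fun _ => True) f y ->
  x 0 = y 0 -> forall t, x t = y t.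
Proof.
  intros hK hf hx hy e t. destruct (Rle_dec 0 t) as [h | h].
  - apply (solution_unique K t f); auto; [| | lra]; intros s _.
    + now apply hx.
    + now apply hy.
  - assert (e' : forall s, 0 <= s <= - t -> x (- s) = y (- s)).
    { apply (solution_unique K (- t) (fun s u => - f (- s) u) (fun s => x (- s))
        (fun s => y (- s))); auto.
      - intros s u v. replace (- f (- s) u - - f (- s) v) with (- (f (- s) u - f (- s) v)) by ring.
        rewrite Rabs_Ropp. apply hf.
      - intros s _. apply is_derive_reflect. now apply hx.
      - intros s _. apply is_derive_reflect. now apply hy.
      - now rewrite Ropp_0. }
    rewrite <- (Ropp_involutive t). apply e'. lra.
Qed.

(** In the norm weighted by [exp (-2 K |t|)], integrating a [K]-Lipschitz field contracts by
    the factor [1/2]; hence the Picard iterates converge on the whole line at once, and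
    no gluing of local solutions is needed. *)
Lemma weighted_bound (K M : R) (d u : R -> R) :
  0 < K -> 0 <= M -> (forall t, is_derive d t (u t)) -> d 0 = 0 ->
  (forall t, Rabs (u t) <= K * (M * exp (2 * K * Rabs t))) ->
  forall t, Rabs (d t) <= M / 2 * exp (2 * K * Rabs t).
Proof.
  intros hK hM.
  assert (forward : forall d u, (forall t, is_derive d t (u t)) -> d 0 = 0 ->
    (forall t, Rabs (u t) <= K * (M * exp (2 * K * Rabs t))) ->
    forall t, 0 <= t -> d t <= M / 2 * exp (2 * K * t)).
  { intros d' u' hd h0 hu t ht.
    assert (h : M / 2 * exp (2 * K * 0) - d' 0 <= M / 2 * exp (2 * K * t) - d' t).
    { apply (nondecreasing (fun t => M / 2 * exp (2 * K * t) - d' t)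
        (fun t => K * (M * exp (2 * K * t)) - u' t)); auto.
      - intros s hs. apply (is_derive_minus (fun t => M / 2 * exp (2 * K * t)) d'); auto.
        auto_derive; auto. field.
      - intros s hs. specialize (hu s). rewrite (Rabs_pos_eq s) in hu by lra.
        apply Rabs_le_between in hu. lra. }
    rewrite Rmult_0_r, exp_0, h0 in h. lra. }
  intros hd h0 hu t.
  assert (abs_forward : forall d u, (forall t, is_derive d t (u t)) -> d 0 = 0 ->
    (forall t, Rabs (u t) <= K * (M * exp (2 * K * Rabs t))) ->
    forall t, 0 <= t -> Rabs (d t) <= M / 2 * exp (2 * K * t)).
  { intros d' u' hd' h0' hu' s hs. apply Rabs_le. split.
    - apply Ropp_le_cancel. rewrite Ropp_involutive.
      apply (forward (fun t => - d' t) (fun t => - u' t)); auto; [| lra |].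
      + intros r. apply (is_derive_opp d'). auto.
      + intros r. rewrite Rabs_Ropp. auto.
    - apply (forward d' u'); auto. }
  destruct (Rle_dec 0 t) as [h | h].
  - rewrite (Rabs_pos_eq t) by lra. apply (abs_forward d u); auto.
  - rewrite (Rabs_left t) by lra. rewrite <- (Ropp_involutive t) at 1.
    apply (abs_forward (fun s => d (- s)) (fun s => - u (- s))); auto; [| | | lra].
    + intros s. now apply is_derive_reflect.
    + now rewrite Ropp_0.
    + intros s. rewrite Rabs_Ropp, <- (Rabs_Ropp s). apply hu.
Qed.

Section Picard.

Variables (f : R -> R -> R) (C K x0 : R).
Hypotheses (hK : 0 < K) (hC : forall t x, Rabs (f t x) <= C) (hL : lipschitz K f).
Hypothesis hcont : forall u, (forall t, continuous u t) -> forall t, continuous (fun s => f s (u s)) t.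

Fixpoint picard_iterate (n : nat) : R -> R :=
  match n with
  | O => fun _ => x0
  | S n => fun t => x0 + RInt (fun s => f s (picard_iterate n s)) 0 t
  end.

Lemma is_derive_picard (u : R -> R) (t : R) :
  (forall t, continuous u t) ->
  is_derive (fun t => x0 + RInt (fun s => f s (u s)) 0 t) t (f t (u t)).
Proof.
  intros hu. eapply is_derive_eq.
  - apply (@is_derive_plus R_AbsRing R_NormedModule (fun _ => x0)).
    + apply is_derive_const.
    + apply (is_derive_primitive (fun s => f s (u s))). auto.
  - apply Rplus_0_l.
Qed.

Lemma picard_iterate_continuous (n : nat) (t : R) : continuous (picard_iterate n) t.
Proof.
  revert t. induction n as [|n IH]; intros t.
  - apply continuous_const.
  - apply (is_derive_continuous _ t (f t (picard_iterate n t))), is_derive_picard, IH.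
Qed.

Lemma picard_iterate_0 (n : nat) : picard_iterate n 0 = x0.
Proof. destruct n; simpl; [|rewrite RInt_0_0]; ring. Qed.

Let A := C / K.

Lemma A_nonneg : 0 <= A.
Proof.
  apply Rmult_le_pos; [|left; now apply Rinv_0_lt_compat].
  eapply Rle_trans; [apply Rabs_pos | apply (hC 0 0)].
Qed.

Lemma picard_step (n : nat) (t : R) :
  Rabs (picard_iterate (S n) t - picard_iterate n t) <= A / 2 ^ n * exp (2 * K * Rabs t).
Proof.
  pose proof A_nonneg as hA.
  revert t. induction n as [|n IH]; intros t.
  - eapply Rle_trans.
    + apply (weighted_bound K A (fun t => picard_iterate 1 t - picard_iterate 0 t)
        (fun t => f t x0 - 0)); auto.
      * intros s. apply (is_derive_minus (picard_iterate 1) (picard_iterate 0)).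
        -- apply (is_derive_picard (fun _ => x0)). intros r. apply continuous_const.
        -- apply (@is_derive_const R_AbsRing R_NormedModule).
      * rewrite !picard_iterate_0. ring.
      * intros s. rewrite Rminus_0_r.
        replace (K * (A * exp (2 * K * Rabs s))) with (C * exp (2 * K * Rabs s))
          by (unfold A; field; lra).
        assert (1 <= exp (2 * K * Rabs s)).
        { apply one_le_exp. pose proof (Rabs_pos s). nra. }
        pose proof (hC s x0). pose proof (Rabs_pos (f s x0)). nra.
    + pose proof (exp_pos (2 * K * Rabs t)). simpl. nra.
  - replace (A / 2 ^ S n) with (A / 2 ^ n / 2) by (simpl; field; apply pow_nonzero; lra).
    apply (weighted_bound K (A / 2 ^ n)
      (fun t => picard_iterate (S (S n)) t - picard_iterate (S n) t)
      (fun t => f t (picard_iterate (S n) t) - f t (picard_iterate n t))); auto.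
    + apply Rmult_le_pos; auto. left. apply Rinv_0_lt_compat, pow_lt. lra.
    + intros s. apply (is_derive_minus (picard_iterate (S (S n))) (picard_iterate (S n)));
        apply is_derive_picard; apply picard_iterate_continuous.
    + rewrite !picard_iterate_0. ring.
    + intros s. eapply Rle_trans; [apply hL|]. apply Rmult_le_compat_l; auto. lra.
Qed.

Lemma picard_cauchy (n k : nat) (t : R) :
  Rabs (picard_iterate (n + k) t - picard_iterate n t)
    <= 2 * A / 2 ^ n * (1 - / 2 ^ k) * exp (2 * K * Rabs t).
Proof.
  induction k as [|k IH].
  - rewrite Nat.add_0_r, Rminus_diag, Rabs_R0. simpl. right. field. apply pow_nonzero. lra.
  - rewrite Nat.add_succ_r.
    replace (picard_iterate (S (n + k)) t - picard_iterate n t) with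
      ((picard_iterate (S (n + k)) t - picard_iterate (n + k) t)
       + (picard_iterate (n + k) t - picard_iterate n t)) by ring.
    eapply Rle_trans; [apply Rabs_triang|].
    eapply Rle_trans; [apply Rplus_le_compat; [apply picard_step | exact IH]|].
    right. rewrite pow_add. simpl. field. split; apply pow_nonzero; lra.
Qed.

Lemma picard_cauchy_le (n k : nat) (t : R) :
  Rabs (picard_iterate (n + k) t - picard_iterate n t) <= 2 * A / 2 ^ n * exp (2 * K * Rabs t).
Proof.
  eapply Rle_trans; [apply picard_cauchy|].
  apply Rmult_le_compat_r; [left; apply exp_pos|].
  assert (0 < / 2 ^ k) by (apply Rinv_0_lt_compat, pow_lt; lra).
  assert (0 < / 2 ^ n) by (apply Rinv_0_lt_compat, pow_lt; lra).
  pose proof A_nonneg. unfold Rdiv.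
  assert (0 <= 2 * A * / 2 ^ n) by nra. nra.
Qed.

Lemma geometric_small (c eps : R) : 0 < eps -> exists n, c / 2 ^ n < eps.
Proof.
  intros he.
  destruct (pow_lt_1_zero (/ 2)) with (y := eps / (Rabs c + 1)) as [N hN].
  - rewrite Rabs_pos_eq; lra.
  - apply Rdiv_lt_0_compat; auto. pose proof (Rabs_pos c). lra.
  - exists N. specialize (hN N (le_n N)).
    rewrite pow_inv, Rabs_pos_eq in hN by (left; apply Rinv_0_lt_compat, pow_lt; lra).
    pose proof (Rabs_pos c). pose proof (Rle_abs c).
    assert (0 < / 2 ^ N) by (apply Rinv_0_lt_compat, pow_lt; lra).
    apply (Rmult_lt_compat_r (Rabs c + 1)) in hN; [|lra].
    unfold Rdiv in hN at 1. rewrite Rmult_assoc, Rinv_l in hN by lra.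
    unfold Rdiv. nra.
Qed.

Definition picard_limit (t : R) : R := real (Lim_seq (fun n => picard_iterate n t)).

Lemma picard_limit_correct (t : R) :
  is_lim_seq (fun n => picard_iterate n t) (picard_limit t).
Proof.
  apply Lim_seq_correct', ex_lim_seq_cauchy_corr. intros eps.
  destruct (geometric_small (4 * A * exp (2 * K * Rabs t)) eps (cond_pos eps)) as [N hN].
  exists N. intros n m hn hm.
  replace n with (N + (n - N))%nat by lia. replace m with (N + (m - N))%nat by lia.
  pose proof (picard_cauchy_le N (n - N) t) as h1.
  pose proof (picard_cauchy_le N (m - N) t) as h2.
  apply Rle_lt_trans with (2 := hN).
  replace (4 * A * exp (2 * K * Rabs t) / 2 ^ N) with
    (2 * A / 2 ^ N * exp (2 * K * Rabs t) + 2 * A / 2 ^ N * exp (2 * K * Rabs t))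
    by (field; apply pow_nonzero; lra).
  apply Rabs_le_between in h1. apply Rabs_le_between in h2. apply Rabs_le. lra.
Qed.

Lemma is_lim_seq_abs_le (u : nat -> R) (l a b : R) :
  is_lim_seq u l -> (forall n, Rabs (u n - a) <= b) -> Rabs (l - a) <= b.
Proof.
  intros hu hb.
  apply (is_lim_seq_le (fun n => Rabs (u n - a)) (fun _ => b) (Rabs (l - a)) b hb).
  - apply (is_lim_seq_abs (fun n => u n - a) (l - a)).
    apply (is_lim_seq_minus' u (fun _ => a)); auto. apply is_lim_seq_const.
  - apply is_lim_seq_const.
Qed.

Lemma picard_limit_close (n : nat) (t : R) :
  Rabs (picard_limit t - picard_iterate n t) <= 2 * A / 2 ^ n * exp (2 * K * Rabs t).
Proof.
  apply (is_lim_seq_abs_le (fun k => picard_iterate (k + n) t)).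
  - apply (is_lim_seq_incr_n (fun k => picard_iterate k t)), picard_limit_correct.
  - intros k. rewrite Nat.add_comm. apply picard_cauchy_le.
Qed.

Lemma picard_iterate_lipschitz (n : nat) (s t : R) :
  Rabs (picard_iterate n t - picard_iterate n s) <= C * Rabs (t - s).
Proof.
  assert (0 <= C) by (eapply Rle_trans; [apply Rabs_pos | apply (hC 0 0)]).
  assert (ordered : forall s t, s <= t ->
    Rabs (picard_iterate n t - picard_iterate n s) <= C * Rabs (t - s)).
  { intros a b hab. destruct n as [|m].
    - simpl. rewrite Rminus_diag, Rabs_R0. apply Rmult_le_pos; auto. apply Rabs_pos.
    - destruct (mean_value (picard_iterate (S m)) (fun r => f r (picard_iterate m r)) a b)
        as [c [_ e]]; auto.
      + intros r _. apply is_derive_picard, picard_iterate_continuous.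
      + rewrite e, Rabs_mult. apply Rmult_le_compat_r; [apply Rabs_pos | apply hC]. }
  destruct (Rle_dec s t); auto. rewrite Rabs_minus_sym, (Rabs_minus_sym t). apply ordered. lra.
Qed.

Lemma picard_limit_continuous (t : R) : continuous picard_limit t.
Proof.
  apply (lipschitz_continuous _ C).
  - eapply Rle_trans; [apply Rabs_pos | apply (hC 0 0)].
  - intros u s. rewrite <- (Rminus_0_r (picard_limit u - picard_limit s)).
    apply (is_lim_seq_abs_le (fun n => picard_iterate n u - picard_iterate n s)).
    + apply is_lim_seq_minus'; apply picard_limit_correct.
    + intros n. rewrite Rminus_0_r. apply picard_iterate_lipschitz.
Qed.

(** The integral of the limiting field has the derivative needed to apply [weighted_bound]
    against each iterate, so no theorem on limits of integrals is involved. *)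
Lemma picard_limit_fixed (t : R) :
  x0 + RInt (fun s => f s (picard_limit s)) 0 t = picard_limit t.
Proof.
  pose proof A_nonneg as hA.
  set (y := fun t => x0 + RInt (fun s => f s (picard_limit s)) 0 t).
  assert (hy : forall n, Rabs (y t - picard_iterate (S n) t) <= 2 * A / 2 ^ n / 2 * exp (2 * K * Rabs t)).
  { intros n. apply (weighted_bound K (2 * A / 2 ^ n) (fun t => y t - picard_iterate (S n) t)
      (fun t => f t (picard_limit t) - f t (picard_iterate n t))); auto.
    - apply Rmult_le_pos; [lra|]. left. apply Rinv_0_lt_compat, pow_lt. lra.
    - intros s. apply (is_derive_minus y (picard_iterate (S n)));
        apply is_derive_picard; [apply picard_limit_continuous | apply picard_iterate_continuous].
    - rewrite picard_iterate_0. unfold y. rewrite RInt_0_0. ring.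
    - intros s. eapply Rle_trans; [apply hL|]. apply Rmult_le_compat_l; [lra|].
      apply picard_limit_close. }
  destruct (Req_dec (y t) (picard_limit t)) as [e | ne]; auto. exfalso.
  destruct (geometric_small (2 * A * exp (2 * K * Rabs t)) (Rabs (y t - picard_limit t)))
    as [n hn].
  - apply Rabs_pos_lt. lra.
  - specialize (hy n). pose proof (picard_limit_close (S n) t) as hc.
    assert (Rabs (y t - picard_limit t) <= 2 * A * exp (2 * K * Rabs t) / 2 ^ n); [|lra].
    replace (y t - picard_limit t) with
      ((y t - picard_iterate (S n) t) - (picard_limit t - picard_iterate (S n) t)) by ring.
    eapply Rle_trans; [apply Rabs_triang|]. rewrite Rabs_Ropp.
    eapply Rle_trans; [apply Rplus_le_compat; eassumption|].
    right. simpl. field. apply pow_nonzero. lra.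
Qed.

Lemma picard_existence :
  exists x, solution_on (fun _ => True) f x /\ x 0 = x0.
Proof.
  exists (fun t => x0 + RInt (fun s => f s (picard_limit s)) 0 t). split.
  - intros t _. rewrite picard_limit_fixed. apply is_derive_picard, picard_limit_continuous.
  - rewrite RInt_0_0. ring.
Qed.

End Picard.

(** * Periodic functions *)

Lemma periodic_representative (T t : R) :
  0 < T -> exists s, 0 <= s <= T /\ forall g, periodic T g -> g t = g s.
Proof.
  intros hT.
  assert (shift : forall g, periodic T g -> forall n s, g (s + INR n * T) = g s).
  { intros g hg n s. induction n as [|n IH].
    - simpl. f_equal. ring.
    - rewrite S_INR, <- IH, <- (hg (s + INR n * T)). f_equal. ring. }
  assert (shiftZ : forall g, periodic T g -> forall n s, g (s + IZR n * T) = g s).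
  { intros g hg n s. destruct (Z_le_gt_dec 0 n) as [h | h].
    - rewrite <- (Z2Nat.id n), <- INR_IZR_INZ by lia. now apply shift.
    - rewrite <- (shift g hg (Z.to_nat (- n)) (s + IZR n * T)). f_equal.
      rewrite INR_IZR_INZ, Z2Nat.id, opp_IZR by lia. ring. }
  exists (t + IZR (1 - up (t / T)) * T). split.
  - destruct (archimed (t / T)) as [h1 h2]. rewrite minus_IZR.
    assert (e : t = t / T * T) by (field; lra).
    set (u := IZR (up (t / T))) in *. rewrite e at 1 2. nra.
  - intros g hg. symmetry. now apply shiftZ.
Qed.

Lemma bounded_on_segment (f : R -> R) (a b : R) :
  a <= b -> (forall t, a <= t <= b -> continuity_pt f t) ->
  exists H, 0 <= H /\ forall t, a <= t <= b -> Rabs (f t) <= H.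
Proof.
  intros hab hf.
  destruct (continuity_ab_maj f a b hab hf) as [M [hM _]].
  destruct (continuity_ab_min f a b hab hf) as [m [hm _]].
  exists (Rabs (f M) + Rabs (f m)). split.
  - pose proof (Rabs_pos (f M)). pose proof (Rabs_pos (f m)). lra.
  - intros t ht. specialize (hM t ht). specialize (hm t ht).
    pose proof (Rle_abs (f M)). pose proof (Rle_abs (- f m)). rewrite Rabs_Ropp in *.
    pose proof (Rabs_pos (f M)). pose proof (Rabs_pos (f m)).
    apply Rabs_le. lra.
Qed.

Lemma periodic_bounded (T : R) (g : R -> R) :
  0 < T -> periodic T g -> (forall t, continuous g t) ->
  exists H, 0 <= H /\ forall t, Rabs (g t) <= H.
Proof.
  intros hT hg hc.
  destruct (bounded_on_segment g 0 T) as [H [hH0 hH]]; [lra | |].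
  - intros t _. apply continuity_pt_filterlim, hc.
  - exists H. split; auto. intros t.
    destruct (periodic_representative T t hT) as [s [hs e]]. rewrite (e g hg). auto.
Qed.

(** * The truncated Riccati equation and its periodic solutions *)

Definition clip (r x : R) : R := Rmax (- r) (Rmin r x).

(** Solutions of the Riccati equation may blow up; this bounded Lipschitz field coincides with it
    on [|x| <= r] and has a displacement map defined everywhere. *)
Definition truncated (r : R) (h : R -> R) (t x : R) : R := clip r x ^ 2 + h t.

Lemma clip_lipschitz (r x y : R) :
  0 <= r -> Rabs (clip r x ^ 2 - clip r y ^ 2) <= 2 * r * Rabs (x - y).
Proof.
  intros hr.
  assert (ordered : forall x y, x <= y -> Rabs (clip r x ^ 2 - clip r y ^ 2) <= 2 * r * (y - x)).
  { intros a b hab. apply Rabs_le. unfold clip, Rmax, Rmin.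
    destruct (Rle_dec r a), (Rle_dec r b); try lra;
      repeat destruct (Rle_dec _ _); nra. }
  destruct (Rle_dec x y) as [h | h].
  - rewrite (Rabs_left1 (x - y)) by lra. specialize (ordered x y h). lra.
  - rewrite Rabs_minus_sym, (Rabs_pos_eq (x - y)) by lra. apply ordered. lra.
Qed.

Lemma clip_id (r x : R) : Rabs x <= r -> clip r x = x.
Proof.
  intros h. apply Rabs_le_between in h. unfold clip.
  rewrite Rmin_right, Rmax_right; lra.
Qed.

Lemma clip_sqr_le (r x : R) : 0 <= r -> clip r x ^ 2 <= x ^ 2.
Proof.
  intros hr. unfold clip, Rmax, Rmin. repeat destruct (Rle_dec _ _); nra.
Qed.

Lemma clip_sqr_bounded (r x : R) : 0 <= r -> clip r x ^ 2 <= r ^ 2.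
Proof.
  intros hr. unfold clip, Rmax, Rmin. repeat destruct (Rle_dec _ _); nra.
Qed.

Lemma truncated_lipschitz (r : R) (h : R -> R) :
  0 <= r -> lipschitz (2 * r) (truncated r h).
Proof.
  intros hr t x y. unfold truncated.
  replace (clip r x ^ 2 + h t - (clip r y ^ 2 + h t)) with (clip r x ^ 2 - clip r y ^ 2) by ring.
  now apply clip_lipschitz.
Qed.

Lemma truncated_existence (r H x0 : R) (h : R -> R) :
  0 < r -> (forall t, continuous h t) -> (forall t, Rabs (h t) <= H) ->
  exists x, solution_on (fun _ => True) (truncated r h) x /\ x 0 = x0.
Proof.
  intros hr hc hH.
  apply (picard_existence (truncated r h) (r ^ 2 + H) (2 * r)); [lra | | |].
  - intros t x. unfold truncated. specialize (hH t).
    pose proof (pow2_ge_0 (clip r x)). pose proof (clip_sqr_bounded r x).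
    apply Rabs_le_between in hH. apply Rabs_le. lra.
  - apply truncated_lipschitz. lra.
  - intros u hu t. unfold truncated.
    apply (continuous_plus (fun s => clip r (u s) ^ 2) h); [|apply hc].
    apply (continuous_comp u (fun x => clip r x ^ 2)); [apply hu|].
    apply (lipschitz_continuous _ (2 * r)); [lra|].
    intros x y. apply clip_lipschitz. lra.
Qed.

Definition excursion (H T : R) : R := H + 1 + 2 * H * T.

(** A solution that does not gain over a period satisfies [rho (x c) <= H] at some time
    [c], by the mean value theorem, and is thus at most [H + 1] there; since it can lose at
    most [H T] over any interval, and since [x T <= x 0], it stays within [2 H T] of that value.
    The bound is the same for [x ^ 2] and for its truncation: truncating at that level
    therefore loses no periodic solution and creates none. *)
Lemma excursion_bound (H T : R) (rho h x : R -> R) :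
  0 < T -> (forall u, 0 <= rho u) -> (forall u, rho u <= H -> Rabs u <= H + 1) ->
  (forall t, Rabs (h t) <= H) ->
  solution_on (fun t => 0 <= t <= T) (fun t u => rho u + h t) x -> x T <= x 0 ->
  forall t, 0 <= t <= T -> Rabs (x t) <= excursion H T.
Proof.
  intros hT rho_pos rho_coercive hH hx hTx t ht.
  assert (drift : forall a b, 0 <= a -> a <= b -> b <= T -> x a - H * T <= x b).
  { intros a b h0a hab hbT.
    destruct (mean_value x (fun s => rho (x s) + h s) a b hab) as [c [hc e]].
    - intros s hs. apply hx. lra.
    - specialize (hH c). apply Rabs_le_between in hH. specialize (rho_pos (x c)).
      assert (0 <= H) by lra. nra. }
  destruct (mean_value x (fun s => rho (x s) + h s) 0 T) as [c [hc e]]; [lra | auto |].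
  assert (hxc : Rabs (x c) <= H + 1).
  { apply rho_coercive. specialize (hH c). apply Rabs_le_between in hH. nra. }
  assert (hH0 : 0 <= H) by (eapply Rle_trans; [apply Rabs_pos | apply (hH 0)]).
  assert (hlo : x c - 2 * (H * T) <= x t).
  { assert (0 <= H * T) by nra. destruct (Rle_dec c t).
    - assert (x c - H * T <= x t) by (apply drift; lra). lra.
    - assert (x 0 - H * T <= x t) by (apply drift; lra).
      assert (x c - H * T <= x T) by (apply drift; lra). lra. }
  assert (hhi : x t <= x c + 2 * (H * T)).
  { assert (0 <= H * T) by nra. destruct (Rle_dec t c).
    - assert (x t - H * T <= x c) by (apply drift; lra). lra.
    - assert (x t - H * T <= x T) by (apply drift; lra).
      assert (x 0 - H * T <= x c) by (apply drift; lra). lra. }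
  apply Rabs_le_between in hxc. apply Rabs_le. unfold excursion. lra.
Qed.

Lemma displacement_eq (T : R) (f : R -> R -> R) (x0 d : R) :
  is_displacement T f x0 d -> (forall d', is_displacement T f x0 d' -> d' = d) ->
  displacement T f x0 = d.
Proof.
  intros hd hu. apply hu.
  apply (iota_correct (V := R_CompleteNormedModule) (is_displacement T f x0)).
  exists d. split; auto. intros d' hd'. symmetry. auto.
Qed.

Lemma displacement_lipschitz (K T : R) (f : R -> R -> R) (x : R -> R) :
  0 <= T -> 0 <= K -> lipschitz K f -> solution_on (fun t => 0 <= t <= T) f x ->
  displacement T f (x 0) = x T - x 0.
Proof.
  intros hT hK hf hx. apply displacement_eq.
  - now exists x.
  - intros d [y [hy [e <-]]]. rewrite (solution_unique K T f y x); auto. lra.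
Qed.

Section Truncation.

Variables (T H : R).
Hypotheses (hT : 0 < T) (hH0 : 0 <= H).

Let r := excursion H T.

Lemma excursion_ge : H + 1 <= r.
Proof. unfold r, excursion. nra. Qed.

Lemma truncated_excursion (h x : R -> R) :
  (forall t, Rabs (h t) <= H) ->
  solution_on (fun t => 0 <= t <= T) (truncated r h) x -> x T <= x 0 ->
  forall t, 0 <= t <= T -> Rabs (x t) <= r.
Proof.
  intros hH hx hle. pose proof excursion_ge.
  apply (excursion_bound H T (fun u => clip r u ^ 2) h x); auto.
  - intros u. apply pow2_ge_0.
  - intros u hu. destruct (Rle_dec (Rabs u) r) as [hr | hr].
    + rewrite clip_id in hu by exact hr. rewrite <- (pow2_abs u) in hu.
      pose proof (Rabs_pos u). nra.
    + assert (e : clip r u ^ 2 = r ^ 2).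
      { revert hr. unfold clip, Rmax, Rmin, Rabs.
        destruct (Rcase_abs u); intros; repeat destruct (Rle_dec _ _); nra. }
      rewrite e in hu. nra.
Qed.

Lemma riccati_excursion (h x : R -> R) :
  (forall t, Rabs (h t) <= H) ->
  solution_on (fun t => 0 <= t <= T) (riccati h) x -> x T <= x 0 ->
  forall t, 0 <= t <= T -> Rabs (x t) <= r.
Proof.
  intros hH hx hle.
  apply (excursion_bound H T (fun u => u ^ 2) h x); auto.
  - intros u. apply pow2_ge_0.
  - intros u hu. rewrite <- (pow2_abs u) in hu. pose proof (Rabs_pos u). nra.
Qed.

Lemma truncated_displacement_riccati (h x : R -> R) :
  (forall t, Rabs (h t) <= H) ->
  solution_on (fun t => 0 <= t <= T) (riccati h) x -> x T <= x 0 ->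
  displacement T (truncated r h) (x 0) = x T - x 0.
Proof.
  intros hH hx hle. pose proof excursion_ge.
  apply (displacement_lipschitz (2 * r)); [lra | lra | apply truncated_lipschitz; lra |].
  intros t ht. unfold truncated. rewrite clip_id; [now apply hx|].
  now apply (riccati_excursion h).
Qed.

Lemma truncated_displacement_spec (h : R -> R) (x0 : R) :
  (forall t, continuous h t) -> (forall t, Rabs (h t) <= H) ->
  exists x, solution_on (fun _ => True) (truncated r h) x /\ x 0 = x0 /\
    displacement T (truncated r h) x0 = x T - x0.
Proof.
  intros hc hH. pose proof excursion_ge.
  destruct (truncated_existence r H x0 h) as [x [hx e]]; auto; [lra|].
  exists x. split; [exact hx|]. split; [exact e|]. rewrite <- e.
  apply (displacement_lipschitz (2 * r)); [lra | lra | apply truncated_lipschitz; lra |].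
  intros t _. now apply hx.
Qed.

Lemma truncated_displacement_initial (h : R -> R) (x0 : R) :
  (forall t, continuous h t) -> (forall t, Rabs (h t) <= H) ->
  displacement T (truncated r h) x0 <= 0 -> Rabs x0 <= r.
Proof.
  intros hc hH hd. destruct (truncated_displacement_spec h x0 hc hH) as [x [hx [e ed]]].
  rewrite <- e. apply (truncated_excursion h); auto; [intros t _; now apply hx | lra | lra].
Qed.

Definition displacement_constant : R := 1 + (1 + T) * exp (2 * r * T).

Lemma truncated_displacement_lipschitz (h1 h2 : R -> R) (x1 x2 b : R) :
  (forall t, continuous h1 t) -> (forall t, Rabs (h1 t) <= H) ->
  (forall t, continuous h2 t) -> (forall t, Rabs (h2 t) <= H) ->
  (forall t, Rabs (h1 t - h2 t) <= b) ->
  Rabs (displacement T (truncated r h1) x1 - displacement T (truncated r h2) x2)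
    <= displacement_constant * (Rabs (x1 - x2) + b).
Proof.
  intros hc1 hH1 hc2 hH2 hb. pose proof excursion_ge.
  assert (hb0 : 0 <= b) by (eapply Rle_trans; [apply Rabs_pos | apply (hb 0)]).
  destruct (truncated_displacement_spec h1 x1 hc1 hH1) as [u [hu [eu ->]]].
  destruct (truncated_displacement_spec h2 x2 hc2 hH2) as [v [hv [ev ->]]].
  assert (hg : Rabs (u T - v T) <= (Rabs (x1 - x2) + b * T) * exp (2 * r * T)).
  { apply (gronwall (2 * r) (Rabs (x1 - x2)) b T (fun t => u t - v t)
      (fun t => truncated r h1 t (u t) - truncated r h2 t (v t))); auto; try lra.
    - apply Rabs_pos.
    - intros t _. apply (is_derive_minus u v); [now apply hu | now apply hv].
    - intros t _. unfold truncated.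
      replace (clip r (u t) ^ 2 + h1 t - (clip r (v t) ^ 2 + h2 t)) with
        ((clip r (u t) ^ 2 - clip r (v t) ^ 2) + (h1 t - h2 t)) by ring.
      eapply Rle_trans; [apply Rabs_triang|]. apply Rplus_le_compat; auto.
      apply clip_lipschitz. lra.
    - rewrite eu, ev. lra. }
  replace (u T - x1 - (v T - x2)) with ((u T - v T) - (x1 - x2)) by ring.
  eapply Rle_trans; [apply Rabs_triang|]. rewrite Rabs_Ropp.
  unfold displacement_constant. pose proof (exp_pos (2 * r * T)).
  pose proof (Rabs_pos (x1 - x2)).
  assert (0 <= T * exp (2 * r * T)) by nra.
  assert (0 <= b * exp (2 * r * T)) by nra. nra.
Qed.

Lemma displacement_constant_pos : 0 < displacement_constant.
Proof.
  unfold displacement_constant. pose proof (exp_pos (2 * r * T)). nra.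
Qed.

Lemma truncated_displacement_continuous (h : R -> R) :
  (forall t, continuous h t) -> (forall t, Rabs (h t) <= H) ->
  forall x, continuous (displacement T (truncated r h)) x.
Proof.
  intros hc hH. pose proof displacement_constant_pos.
  apply (lipschitz_continuous _ displacement_constant); [lra|]. intros x y.
  rewrite <- (Rplus_0_r (Rabs (x - y))).
  apply truncated_displacement_lipschitz; auto.
  intros t. rewrite Rminus_diag, Rabs_R0. lra.
Qed.

(** A zero of the truncated displacement is the initial value of a periodic solution of the
    truncated equation, and the excursion bound keeps that solution where nothing was cut. *)
Lemma periodic_solution_of_zero (h : R -> R) (x0 : R) :
  (forall t, continuous h t) -> (forall t, Rabs (h t) <= H) -> periodic T h ->
  displacement T (truncated r h) x0 = 0 ->
  exists phi, periodic_solution T (riccati h) phi /\ phi 0 = x0.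
Proof.
  intros hc hH hp hd. pose proof excursion_ge.
  destruct (truncated_displacement_spec h x0 hc hH) as [x [hx [e ed]]].
  assert (px : periodic T x).
  { intros t0. apply (solution_unique_global (2 * r) (truncated r h) (fun t => x (t + T)) x); auto.
    - lra.
    - apply truncated_lipschitz. lra.
    - intros t _. unfold truncated. rewrite <- (hp t).
      eapply is_derive_eq.
      + apply (is_derive_comp x (fun t => t + T)); [now apply hx|].
        auto_derive; auto.
      + unfold scal; simpl; unfold mult; simpl. unfold truncated. ring.
    - rewrite Rplus_0_l. lra. }
  exists x. split; auto. split; auto. intros t _.
  assert (ht : Rabs (x t) <= r).
  { destruct (periodic_representative T t hT) as [s [hs es]]. rewrite (es x px).
    apply (truncated_excursion h); auto; [intros u _; now apply hx | lra]. }
  specialize (hx t I). unfold truncated in hx. now rewrite clip_id in hx.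
Qed.

End Truncation.

Lemma periodic_solution_of_segment (T : R) (h x : R -> R) :
  0 < T -> (forall t, continuous h t) -> periodic T h ->
  solution_on (fun t => 0 <= t <= T) (riccati h) x -> x T = x 0 ->
  exists phi, periodic_solution T (riccati h) phi /\ phi 0 = x 0.
Proof.
  intros hT hc hp hx e. destruct (periodic_bounded T h hT hp hc) as [H [hH0 hH]].
  apply (periodic_solution_of_zero T H); auto.
  rewrite truncated_displacement_riccati; auto; lra.
Qed.

(** The truncated displacement is nonpositive at [p 0], because a subsolution stays above the
    solution with the same initial value, and positive beyond the excursion bound; it
    vanishes in between. *)
Lemma periodic_solution_of_subsolution (T : R) (h p dp : R -> R) :
  0 < T -> (forall t, continuous h t) -> periodic T h ->
  (forall t, is_derive p t (dp t)) -> periodic T p ->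
  (forall t, p t ^ 2 + h t <= dp t) ->
  exists phi, periodic_solution T (riccati h) phi.
Proof.
  intros hT hc hp hdp pp hle. destruct (periodic_bounded T h hT hp hc) as [H [hH0 hH]].
  set (r := excursion H T). pose proof (excursion_ge T H hT hH0) as hr. fold r in hr.
  set (d := displacement T (truncated r h)).
  assert (d_p : d (p 0) <= 0).
  { destruct (truncated_displacement_spec T H hT hH0 h (p 0) hc hH) as [x [hx [e ed]]].
    unfold d, r. rewrite ed.
    assert (x T - p T <= 0).
    { apply (comparison (2 * r) T (fun t => x t - p t)
        (fun t => truncated r h t (x t) - dp t)); try lra.
      - intros t _. apply (is_derive_minus x p); [apply (hx t I) | apply hdp].
      - intros t _ pos. unfold truncated. specialize (hle t).
        pose proof (clip_sqr_le r (p t) ltac:(lra)).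
        pose proof (clip_lipschitz r (x t) (p t) ltac:(lra)) as hl.
        rewrite (Rabs_pos_eq (x t - p t)) in hl by lra.
        apply Rabs_le_between in hl. lra. }
    pose proof (periodic_end T p pp). lra. }
  assert (d_r : 0 <= d (r + 1)).
  { destruct (Rle_dec 0 (d (r + 1))) as [|n]; auto. exfalso.
    assert (Rabs (r + 1) <= r).
    { apply (truncated_displacement_initial T H hT hH0 h); auto. fold r. fold d. lra. }
    rewrite Rabs_pos_eq in *; lra. }
  destruct (IVT_gen d (p 0) (r + 1) 0) as [x0 [_ hx0]].
  - intros x. apply continuity_pt_filterlim, (truncated_displacement_continuous T H); auto.
  - rewrite Rmin_left, Rmax_right; lra.
  - destruct (periodic_solution_of_zero T H hT hH0 h x0) as [phi [hphi _]]; auto.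
    now exists phi.
Qed.

(** * Bernoulli's formula for the solutions near a given one *)

(** The Riccati field is only locally Lipschitz, but the difference [z] of two solutions
    satisfies [z' = (x + y) z] with [x + y] bounded on the period. *)
Lemma riccati_displacement (T : R) (h x : R -> R) :
  0 < T -> solution_on (fun t => 0 <= t <= T) (riccati h) x ->
  displacement T (riccati h) (x 0) = x T - x 0.
Proof.
  intros hT hx. apply displacement_eq.
  - now exists x.
  - intros d [y [hy [e <-]]].
    assert (hc : forall u, solution_on (fun t => 0 <= t <= T) (riccati h) u ->
      forall t, 0 <= t <= T -> continuity_pt u t).
    { intros u hu t ht. eapply continuity_pt_filterlim, is_derive_continuous. apply hu, ht. }
    destruct (bounded_on_segment (fun t => y t + x t) 0 T) as [K [hK0 hK]]; [lra | |].
    { intros t ht. apply (continuity_pt_plus y x); now apply hc. }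
    enough (y T - x T = 0) by lra.
    apply (vanishes_of_linear_growth K T (fun t => y t - x t)
      (fun t => riccati h t (y t) - riccati h t (x t))); try lra.
    + intros t ht. apply (is_derive_minus y x); [now apply hy | now apply hx].
    + intros t ht. unfold riccati.
      replace (y t ^ 2 + h t - (x t ^ 2 + h t)) with ((y t + x t) * (y t - x t)) by ring.
      rewrite Rabs_mult. apply Rmult_le_compat_r; [apply Rabs_pos | auto].
Qed.

Definition growth (phi : R -> R) (t : R) : R := exp (2 * RInt phi 0 t).

(** With [x = phi + z] the Riccati equation becomes the Bernoulli equation
    [z' = 2 phi z + z ^ 2]; this is its explicit solution with [z 0 = y0]. *)
Definition neighbour (phi : R -> R) (y0 t : R) : R :=
  phi t + y0 * growth phi t / (1 - y0 * RInt (growth phi) 0 t).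

Lemma growth_pos (phi : R -> R) (t : R) : 0 < growth phi t.
Proof. apply exp_pos. Qed.

Lemma growth_0 (phi : R -> R) : growth phi 0 = 1.
Proof. unfold growth. now rewrite RInt_0_0, Rmult_0_r, exp_0. Qed.

Lemma growth_eq_1 (phi : R -> R) (t : R) : growth phi t = 1 <-> RInt phi 0 t = 0.
Proof.
  unfold growth. split; intros h.
  - rewrite <- exp_0 in h. apply exp_inv in h. lra.
  - rewrite h, Rmult_0_r. apply exp_0.
Qed.

Section Bernoulli.

Variables (h phi : R -> R).
Hypothesis hphi : solution_on (fun _ => True) (riccati h) phi.

Lemma solution_continuous (t : R) : continuous phi t.
Proof. apply (is_derive_continuous phi t (riccati h t (phi t))), hphi, I. Qed.

Lemma is_derive_growth (t : R) : is_derive (growth phi) t (2 * phi t * growth phi t).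
Proof.
  unfold growth. eapply is_derive_eq.
  - apply (is_derive_comp exp (fun t => 2 * RInt phi 0 t)).
    + apply is_derive_exp.
    + apply (is_derive_scal (RInt phi 0) t 2 (phi t)), is_derive_primitive, solution_continuous.
  - reflexivity.
Qed.

Lemma is_derive_growth_integral (t : R) :
  is_derive (RInt (growth phi) 0) t (growth phi t).
Proof.
  apply is_derive_primitive. intros s.
  apply (is_derive_continuous _ s (2 * phi s * growth phi s)), is_derive_growth.
Qed.

Lemma growth_integral_le (s t : R) :
  s <= t -> RInt (growth phi) 0 s <= RInt (growth phi) 0 t.
Proof.
  intros hst. apply (nondecreasing _ (growth phi)); auto.
  - intros r _. apply is_derive_growth_integral.
  - intros r _. left. apply growth_pos.
Qed.

Lemma growth_integral_pos (t : R) : 0 < t -> 0 < RInt (growth phi) 0 t.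
Proof.
  intros ht.
  destruct (mean_value (RInt (growth phi) 0) (growth phi) 0 t) as [c [hc e]].
  - lra.
  - intros r _. apply is_derive_growth_integral.
  - rewrite RInt_0_0 in e. pose proof (growth_pos phi c). nra.
Qed.

Lemma neighbour_0 (y0 : R) : neighbour phi y0 0 = phi 0 + y0.
Proof. unfold neighbour. rewrite growth_0, RInt_0_0. field. Qed.

Lemma neighbour_solution (y0 t : R) :
  1 - y0 * RInt (growth phi) 0 t <> 0 ->
  is_derive (neighbour phi y0) t (riccati h t (neighbour phi y0 t)).
Proof.
  intros hd. unfold neighbour. eapply is_derive_eq.
  - apply (is_derive_plus phi); [now apply hphi|].
    apply (is_derive_div (fun t => y0 * growth phi t) (fun t => 1 - y0 * RInt (growth phi) 0 t)).
    + apply (is_derive_scal (growth phi)), is_derive_growth.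
    + apply (is_derive_minus (fun _ => 1) (fun t => y0 * RInt (growth phi) 0 t)).
      * apply (@is_derive_const R_AbsRing R_NormedModule).
      * apply (is_derive_scal (RInt (growth phi) 0)), is_derive_growth_integral.
    + exact hd.
  - unfold riccati, plus, minus, opp, zero, scal; simpl.
    unfold plus, opp, zero, mult; simpl. unfold mult; simpl. field. exact hd.
Qed.

Lemma neighbour_denominator (y0 t T : R) :
  0 <= t <= T -> 0 < 1 - y0 * RInt (growth phi) 0 T ->
  0 < 1 - y0 * RInt (growth phi) 0 t.
Proof.
  intros ht hd. pose proof (growth_integral_le t T ltac:(lra)).
  pose proof (growth_integral_le 0 t ltac:(lra)). rewrite RInt_0_0 in *.
  destruct (Rle_dec 0 y0); nra.
Qed.

Lemma neighbour_solution_segment (y0 T : R) :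
  0 < 1 - y0 * RInt (growth phi) 0 T ->
  solution_on (fun t => 0 <= t <= T) (riccati h) (neighbour phi y0).
Proof.
  intros hd t ht. apply neighbour_solution.
  pose proof (neighbour_denominator y0 t T ht hd). lra.
Qed.

(** The difference of two solutions satisfies the linear equation [z' = (x + phi) z]. *)
Lemma solution_difference (x : R -> R) (t : R) :
  solution_on (fun _ => True) (riccati h) x ->
  x t - phi t = (x 0 - phi 0) * exp (RInt (fun s => x s + phi s) 0 t).
Proof.
  intros hx.
  set (a := RInt (fun s => x s + phi s) 0).
  assert (hcx : forall s, continuous x s).
  { intros s. apply (is_derive_continuous x s (riccati h s (x s))), hx, I. }
  assert (e : forall t, (x t - phi t) * exp (- a t) = (x 0 - phi 0) * exp (- a 0)).
  { apply (constant_of_derive_0 (fun t => (x t - phi t) * exp (- a t))). intros s.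
    eapply is_derive_eq.
    - apply (is_derive_mult (fun t => x t - phi t) (fun t => exp (- a t))).
      + apply (is_derive_minus x phi); [apply (hx s I) | apply (hphi s I)].
      + apply (is_derive_comp exp (fun t => - a t)); [apply is_derive_exp|].
        apply (is_derive_opp a). apply (is_derive_primitive (fun s => x s + phi s)).
        intros r. apply (continuous_plus x phi); [apply hcx | apply solution_continuous].
      + exact Rmult_comm.
    - unfold riccati, plus, minus, opp, scal; simpl.
      unfold plus, opp, mult; simpl. unfold mult; simpl. ring. }
  specialize (e t). unfold a in e at 2. rewrite RInt_0_0, Ropp_0, exp_0, Rmult_1_r in e.
  rewrite <- e, Rmult_assoc, <- exp_plus. replace (- a t + a t) with 0 by ring.
  rewrite exp_0. ring.
Qed.

Lemma solution_eq (x : R -> R) :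
  solution_on (fun _ => True) (riccati h) x -> x 0 = phi 0 -> x = phi.
Proof.
  intros hx e. apply functional_extensionality. intros t.
  pose proof (solution_difference x t hx) as hd. rewrite e, Rminus_diag, Rmult_0_l in hd. lra.
Qed.

(** The reciprocal of the difference of two solutions satisfies a linear equation, whose
    first integral is [growth / (x - phi) + RInt growth]; equating its values at [0] and [T]
    determines the initial value of any second periodic solution. *)
Lemma second_periodic_solution (T : R) (x : R -> R) :
  periodic T phi -> periodic_solution T (riccati h) x -> x 0 <> phi 0 ->
  (x 0 - phi 0) * RInt (growth phi) 0 T = 1 - growth phi T.
Proof.
  intros pphi [hx px] ne.
  assert (nz : forall t, x t - phi t <> 0).
  { intros t. rewrite (solution_difference x t hx).
    apply Rmult_integral_contrapositive. split; [lra|].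
    pose proof (exp_pos (RInt (fun s => x s + phi s) 0 t)). lra. }
  assert (e : growth phi T / (x T - phi T) + RInt (growth phi) 0 T
    = growth phi 0 / (x 0 - phi 0) + RInt (growth phi) 0 0).
  { apply (constant_of_derive_0
      (fun t => growth phi t / (x t - phi t) + RInt (growth phi) 0 t)). intros t.
    eapply is_derive_eq.
    - apply (is_derive_plus (fun t => growth phi t / (x t - phi t)));
        [|apply is_derive_growth_integral].
      apply (is_derive_div (growth phi) (fun t => x t - phi t)).
      + apply is_derive_growth.
      + apply (is_derive_minus x phi); [apply (hx t I) | apply (hphi t I)].
      + apply nz.
    - unfold riccati, plus, minus, opp; simpl. unfold plus, opp; simpl. field. apply nz. }
  specialize (nz 0). rewrite (periodic_end T x px), (periodic_end T phi pphi), growth_0, RInt_0_0 in e.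
  apply (f_equal (fun u => u * (x 0 - phi 0))) in e. field_simplify in e; [|lra|lra].
  lra.
Qed.

End Bernoulli.

(** * The critical parameter *)

(** Take for [c] the supremum of the parameters at which some displacement is nonpositive. At
    [c] the displacement has minimum [0], by its Lipschitz dependence on the parameter,
    and its zero gives a periodic solution [phi]. Were the mean of [phi] not zero, the
    displacement would change sign at [phi 0], as Bernoulli's formula shows. *)
Lemma critical_parameter (T : R) (g : R -> R) :
  0 < T -> (forall t, continuous g t) -> periodic T g ->
  exists phi c, periodic_solution T (riccati (fun t => g t + c)) phi /\ RInt phi 0 T = 0.
Proof.
  intros hT hg pg. destruct (periodic_bounded T g hT pg hg) as [G [hG0 hG]].
  set (H := 2 * G + 1). assert (hH0 : 0 <= H) by (unfold H; lra).
  set (r := excursion H T). pose proof (excursion_ge T H hT hH0) as hr. fold r in hr.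
  set (h := fun c t => g t + c).
  set (d := fun c => displacement T (truncated r (h c))).
  assert (hc : forall c t, continuous (h c) t).
  { intros c t. apply (continuous_plus g (fun _ => c)); [apply hg | apply continuous_const]. }
  assert (hH : forall c, - (G + 1) <= c <= G + 1 -> forall t, Rabs (h c t) <= H).
  { intros c hcc t. specialize (hG t). apply Rabs_le_between in hG.
    apply Rabs_le. unfold h, H. lra. }
  assert (ph : forall c, periodic T (h c)).
  { intros c t. unfold h. now rewrite pg. }
  set (K := displacement_constant T H). assert (hK : 0 < K) by now apply displacement_constant_pos.
  assert (d_lip : forall c c' x x', - (G + 1) <= c <= G + 1 -> - (G + 1) <= c' <= G + 1 ->
    Rabs (d c x - d c' x') <= K * (Rabs (x - x') + Rabs (c - c'))).
  { intros c c' x x' hcc hcc'. apply truncated_displacement_lipschitz; auto.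
    intros t. unfold h. right. f_equal. ring. }
  (* The bounds on [c] keep the excursion level [r] uniform; the supremum turns out to lie between
     [- G] and [G], so that it can still be increased. *)
  set (E := fun c => - (G + 1) <= c <= G + 1 /\ exists x, d c x <= 0).
  assert (E_le : forall c, E c -> c <= G).
  { intros c [hcc [x hx]].
    destruct (truncated_displacement_spec T H hT hH0 (h c) x (hc c) (hH c hcc))
      as [u [hu [eu ed]]].
    destruct (mean_value u (fun t => truncated r (h c) t (u t)) 0 T) as [s [_ e]]; [lra | |].
    { intros t _. apply (hu t I). }
    unfold d, r in hx. rewrite ed in hx. unfold truncated, h in e.
    pose proof (pow2_ge_0 (clip r (u s))). specialize (hG s). apply Rabs_le_between in hG.
    nra. }
  assert (E_G : E (- G)).
  { assert (hcc : - (G + 1) <= - G <= G + 1) by lra.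
    split; [exact hcc|]. exists 0.
    destruct (truncated_displacement_spec T H hT hH0 (h (- G)) 0 (hc _) (hH _ hcc))
      as [u [hu [eu ed]]].
    unfold d, r. rewrite ed, Rminus_0_r.
    apply (comparison (2 * r) T u (fun t => truncated r (h (- G)) t (u t))); try lra.
    - intros t _. apply (hu t I).
    - intros t _ pos. unfold truncated, h.
      pose proof (clip_lipschitz r (u t) 0 ltac:(lra)) as hl.
      rewrite Rminus_0_r, (Rabs_pos_eq (u t)), (clip_id r 0) in hl
        by (rewrite ?Rabs_R0; lra).
      apply Rabs_le_between in hl. specialize (hG t). apply Rabs_le_between in hG. lra. }
  destruct (completeness E) as [c [c_ub c_lub]].
  { exists G. exact E_le. }
  { now exists (- G). }
  assert (hcG : - G <= c <= G).
  { split; [apply c_ub, E_G | apply c_lub; exact E_le]. }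
  assert (d_nonneg : forall x, 0 <= d c x).
  { intros x. destruct (Rle_dec 0 (d c x)) as [|n]; auto. exfalso.
    set (e := Rmin 1 (- d c x / K)).
    assert (he : 0 < e).
    { unfold e. apply Rmin_glb_lt; [lra|]. apply Rdiv_lt_0_compat; lra. }
    assert (he1 : e <= 1) by apply Rmin_l.
    assert (heK : K * e <= - d c x).
    { apply (Rmult_le_reg_r (/ K)); [now apply Rinv_0_lt_compat|].
      replace (K * e * / K) with e by (field; lra). apply Rmin_r. }
    assert (E (c + e)).
    { split; [lra|]. exists x.
      pose proof (d_lip (c + e) c x x ltac:(lra) ltac:(lra)) as hl.
      rewrite Rminus_diag, Rabs_R0 in hl. replace (c + e - c) with e in hl by ring.
      rewrite (Rabs_pos_eq e) in hl by lra. apply Rabs_le_between in hl. lra. }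
    pose proof (c_ub (c + e) ltac:(assumption)). lra. }
  destruct (continuity_ab_min (d c) (- r) r) as [x0 [x0_min _]]; [lra | |].
  { intros x _. apply continuity_pt_filterlim.
    apply (truncated_displacement_continuous T H); auto. apply hH. lra. }
  assert (d_x0 : d c x0 = 0).
  { destruct (Req_dec (d c x0) 0) as [|n]; auto. exfalso.
    assert (hm : 0 < d c x0) by (specialize (d_nonneg x0); lra).
    set (e := Rmin 1 (d c x0 / (2 * K))).
    assert (he : 0 < e).
    { unfold e. apply Rmin_glb_lt; [lra|]. apply Rdiv_lt_0_compat; lra. }
    assert (heK : K * e <= d c x0 / 2).
    { apply (Rmult_le_reg_r (/ K)); [now apply Rinv_0_lt_compat|].
      replace (K * e * / K) with e by (field; lra).
      replace (d c x0 / 2 * / K) with (d c x0 / (2 * K)) by (field; lra). apply Rmin_r. }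
    assert (near : exists c', E c' /\ c - e < c').
    { apply NNPP. intros none. assert (c <= c - e); [|lra]. apply c_lub. intros c' hc'.
      destruct (Rle_dec c' (c - e)); auto. exfalso. apply none. exists c'. split; auto. lra. }
    destruct near as [c' [[hcc' [x hx]] hec]].
    assert (c' <= c) by (apply c_ub; split; eauto).
    assert (hxr : Rabs x <= r).
    { apply (truncated_displacement_initial T H hT hH0 (h c')); auto. }
    apply Rabs_le_between in hxr. specialize (x0_min x hxr).
    pose proof (d_lip c c' x x ltac:(lra) ltac:(lra)) as hl.
    rewrite Rminus_diag, Rabs_R0, (Rabs_pos_eq (c - c')) in hl by lra.
    apply Rabs_le_between in hl. nra. }
  destruct (periodic_solution_of_zero T H hT hH0 (h c) x0) as [phi [[hphi pphi] e0]]; auto.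
  { apply hH. lra. }
  exists phi, c. split; [now split|].
  apply growth_eq_1. destruct (Req_dec (growth phi T) 1) as [|n]; auto. exfalso.
  pose proof (growth_integral_pos _ _ hphi T hT) as hS.
  pose proof (growth_pos phi T) as hM.
  set (M := growth phi T) in *. set (S := RInt (growth phi) 0 T) in *.
  (* The displacement at [phi 0 + y0] is [y0 (M - 1 + S y0) / (1 - S y0)], negative for [y0]
     strictly between its zeros [0] and [(1 - M) / S]. *)
  set (y0 := (1 - M) / (2 * S)).
  assert (eS : 1 - y0 * S = (1 + M) / 2) by (unfold y0; field; lra).
  pose proof (neighbour_solution_segment _ _ hphi y0 T) as hn. fold S in hn.
  specialize (hn ltac:(lra)).
  assert (drop : neighbour phi y0 T - neighbour phi y0 0 < 0).
  { rewrite (neighbour_0 phi). unfold neighbour. fold M S.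
    rewrite (periodic_end T phi pphi), eS. unfold y0.
    replace (phi 0 + (1 - M) / (2 * S) * M / ((1 + M) / 2) - (phi 0 + (1 - M) / (2 * S)))
      with (- ((1 - M) ^ 2 / (2 * S * (1 + M)))) by (field; lra).
    apply Ropp_lt_gt_0_contravar. apply Rdiv_lt_0_compat; [|nra].
    apply pow2_gt_0. lra. }
  specialize (d_nonneg (neighbour phi y0 0)). unfold d, r in d_nonneg.
  rewrite truncated_displacement_riccati in d_nonneg; auto; try lra.
  apply hH. lra.
Qed.

(** * Variational characterization of the discriminant *)

Lemma average_RInt (T : R) (p : R -> R) : 0 < T -> average T p = 0 -> RInt p 0 T = 0.
Proof.
  unfold average. intros hT h. apply Rmult_integral in h. destruct h as [h|h]; auto.
  pose proof (Rinv_0_lt_compat T hT). lra.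
Qed.

Section Variational.

Variables (T c : R) (g phi : R -> R).
Hypotheses (hT : 0 < T) (hg : forall t, continuous g t).
Hypothesis hphi : solution_on (fun _ => True) (riccati (fun t => g t + c)) phi.
Hypotheses (pphi : periodic T phi) (zphi : RInt phi 0 T = 0).

(** With [e = exp (-2 int phi)], periodic because [phi] has zero mean, the derivative of
    [e (p - phi)] is at least [e ((p - phi) ^ 2 + m - c)]; but this periodic function must
    have a critical point. *)
Lemma subsolution_level (m : R) (p dp : R -> R) :
  (forall t, 0 <= t <= T -> is_derive p t (dp t)) -> p T = p 0 ->
  (forall t, 0 <= t <= T -> p t ^ 2 + g t + m <= dp t) -> m <= c.
Proof.
  intros hdp pp hle.
  set (e := fun t => exp (-2 * RInt phi 0 t)).
  destruct (mean_value (fun t => e t * (p t - phi t))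
    (fun t => e t * (dp t - (phi t ^ 2 + g t + c) - 2 * phi t * (p t - phi t))) 0 T)
    as [s [hs es]]; [lra | |].
  - intros t ht. eapply is_derive_eq.
    + apply (is_derive_mult e (fun t => p t - phi t)).
      * apply (is_derive_comp exp (fun t => -2 * RInt phi 0 t)); [apply is_derive_exp|].
        apply (is_derive_scal (RInt phi 0)), is_derive_primitive.
        intros r. apply (solution_continuous _ _ hphi).
      * apply (is_derive_minus p phi); [now apply hdp | apply (hphi t I)].
      * exact Rmult_comm.
    + unfold e, riccati, plus, minus, opp, scal; simpl.
      unfold plus, opp, mult; simpl. unfold mult; simpl. ring.
  - unfold e at 1 2 in es. pose proof (periodic_end T phi pphi) as e0.
    rewrite zphi, RInt_0_0, pp, e0 in es.
    assert (0 < e s) by apply exp_pos. specialize (hle s hs).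
    assert (hz : dp s - (phi s ^ 2 + g s + c) - 2 * phi s * (p s - phi s) = 0).
    { assert (hz : e s * (dp s - (phi s ^ 2 + g s + c) - 2 * phi s * (p s - phi s)) * (T - 0) = 0)
        by lra.
      apply Rmult_integral in hz. destruct hz as [hz|]; [|lra].
      apply Rmult_integral in hz. destruct hz; lra. }
    pose proof (pow2_ge_0 (p s - phi s)). nra.
Qed.

Lemma mu_lower_spec (p : R -> R) :
  C1T T p ->
  is_maximum (fun t => 0 <= t <= T)
    (fun t => p t ^ 2 + centered T g t - Derive p t) (- mu_lower T g p).
Proof.
  intros [_ hp]. unfold mu_lower. rewrite Ropp_involutive.
  set (f := fun t => p t ^ 2 + centered T g t - Derive p t).
  destruct (continuity_ab_maj f 0 T) as [M [hM hM']]; [lra | |].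
  - intros t _. apply continuity_pt_filterlim. unfold f, centered.
    assert (cp : continuous p t) by (apply (@ex_derive_continuous R_AbsRing R_NormedModule), hp).
    apply (continuous_minus (fun t => p t ^ 2 + (g t - average T g)) (Derive p)); [|apply hp].
    apply (continuous_plus (fun t => p t ^ 2) (fun t => g t - average T g)).
    + now apply continuous_square.
    + apply (continuous_minus g (fun _ => average T g)); auto. apply continuous_const.
  - assert (h : is_maximum (fun t => 0 <= t <= T) f (f M)).
    { split; auto. now exists M. }
    now rewrite (maximum_eq _ _ _ h).
Qed.

Lemma mu_lower_le (p : R -> R) : C1T T p -> mu_lower T g p <= average T g + c.
Proof.
  intros hp. enough (mu_lower T g p - average T g <= c) by lra.
  apply (subsolution_level _ p (Derive p)).
  - intros t _. apply Derive_correct, hp.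
  - apply periodic_end, hp.
  - intros t ht. destruct (mu_lower_spec p hp) as [_ h]. specialize (h t ht).
    unfold centered in h. lra.
Qed.

Lemma critical_C1T : C1T T phi.
Proof.
  split; auto. intros t. split.
  - eexists. apply (hphi t I).
  - apply (continuous_ext (fun t => phi t ^ 2 + (g t + c))).
    + intros s. symmetry. apply is_derive_unique. apply (hphi s I).
    + pose proof (solution_continuous _ _ hphi t) as cp.
      apply (continuous_plus (fun t => phi t ^ 2) (fun t => g t + c)).
      * now apply continuous_square.
      * apply (continuous_plus g (fun _ => c)); auto. apply continuous_const.
Qed.

Lemma mu_lower_critical : mu_lower T g phi = average T g + c.
Proof.
  destruct (mu_lower_spec phi critical_C1T) as [[t [_ e]] _].
  rewrite (is_derive_unique phi t _ (hphi t I)) in e. unfold centered, riccati in e. lra.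
Qed.

(** In particular the maximum defining [gamma_star] is attained, at [phi]. *)
Lemma discriminant_critical : discriminant T g = c.
Proof.
  unfold discriminant, gamma_star. rewrite (maximum_eq _ _ (average T g + c)); [ring|].
  split.
  - exists phi. split; [exact critical_C1T | exact mu_lower_critical].
  - exact mu_lower_le.
Qed.

(** Up to the boundary term [e phi], which has equal values at [0] and [T] as [q] has zero
    mean, the difference of the two sides times the integral of [e] is the integral of
    [e (q - phi) ^ 2], where [e = exp (-2 int q)]. *)
Lemma mu_upper_ge (q : R -> R) : C1T0 T q -> average T g + c <= mu_upper T g q.
Proof.
  intros [[pq hq] zq]. apply average_RInt in zq; auto.
  set (e := fun t => exp (-2 * RInt q 0 t)).
  assert (cq : forall t, continuous q t).
  { intros t. apply (@ex_derive_continuous R_AbsRing R_NormedModule), hq. }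
  assert (de : forall t, is_derive e t (-2 * q t * e t)).
  { intros t. eapply is_derive_eq.
    - apply (is_derive_comp exp (fun t => -2 * RInt q 0 t)); [apply is_derive_exp|].
      apply (is_derive_scal (RInt q 0)), is_derive_primitive, cq.
    - reflexivity. }
  assert (ce : forall t, continuous e t).
  { intros t. apply (is_derive_continuous e t _ (de t)). }
  set (v := fun t => e t * (q t ^ 2 - centered T g t)).
  assert (cv : forall t, continuous v t).
  { intros t. apply (continuous_mult e (fun t => q t ^ 2 - centered T g t)); auto.
    apply (continuous_minus (fun t => q t ^ 2) (centered T g)).
    - apply continuous_square, cq.
    - apply (continuous_minus g (fun _ => average T g)); auto. apply continuous_const. }
  assert (e_int_pos : 0 < RInt e 0 T).
  { destruct (mean_value (RInt e 0) e 0 T) as [s [_ es]]; [lra | |].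
    - intros t _. now apply is_derive_primitive.
    - rewrite RInt_0_0 in es. assert (0 < e s) by apply exp_pos. nra. }
  assert (incr : RInt v 0 0 - (average T g + c) * RInt e 0 0 + e 0 * phi 0
    <= RInt v 0 T - (average T g + c) * RInt e 0 T + e T * phi T).
  { apply (nondecreasing
      (fun t => RInt v 0 t - (average T g + c) * RInt e 0 t + e t * phi t)
      (fun t => e t * (q t - phi t) ^ 2)); [lra | |].
    - intros t _. eapply is_derive_eq.
      + apply (is_derive_plus (fun t => RInt v 0 t - (average T g + c) * RInt e 0 t)
          (fun t => e t * phi t)).
        * apply (is_derive_minus (RInt v 0)).
          -- now apply is_derive_primitive.
          -- apply (is_derive_scal (RInt e 0)). now apply is_derive_primitive.
        * apply (is_derive_mult e phi); [apply de | apply (hphi t I) | exact Rmult_comm].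
      + unfold v, centered, riccati, plus, minus, opp, scal; simpl.
        unfold plus, opp, mult; simpl. unfold mult; simpl. ring.
    - intros t _. apply Rmult_le_pos; [left; apply exp_pos | apply pow2_ge_0]. }
  unfold e at 2 4 in incr. pose proof (periodic_end T phi pphi) as e0.
  rewrite !RInt_0_0, zq, e0, !Rmult_0_r, exp_0 in incr.
  change (mu_upper T g q) with (/ RInt e 0 T * RInt v 0 T). apply (Rmult_le_reg_l (RInt e 0 T)); auto.
  rewrite <- Rmult_assoc, Rinv_r, Rmult_1_l by lra. lra.
Qed.

End Variational.

(** * Limit cycles and their multiplicity *)

Lemma limit_cycle_intro (T : R) (h phi psi : R -> R) :
  periodic_solution T (riccati h) phi ->
  phi 0 <> psi 0 ->
  (forall x, periodic_solution T (riccati h) x -> x = phi \/ x = psi) ->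
  limit_cycle T (riccati h) phi.
Proof.
  intros hphi ne only. split; auto. exists (Rabs (psi 0 - phi 0)). split.
  - apply Rabs_pos_lt. lra.
  - intros x hx close. destruct (only x hx) as [|e]; auto.
    specialize (close 0). rewrite e in close. lra.
Qed.

Lemma multiplicity_of_derivatives (f f1 f2 : R -> R) (a : R) :
  locally a (fun y => is_derive f y (f1 y)) ->
  locally a (fun y => is_derive f1 y (f2 y)) ->
  f a = 0 ->
  (f1 a <> 0 -> zero_of_multiplicity f 1 a) /\
  (f1 a = 0 -> f2 a <> 0 -> zero_of_multiplicity f 2 a).
Proof.
  intros h1 h2 h0.
  assert (e1 : Derive f a = f1 a).
  { apply is_derive_unique. now apply (locally_singleton a _ h1). }
  assert (step : locally a (fun y => is_derive (Derive f) y (f2 y))).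
  { generalize (filter_and _ _ (locally_locally a _ h1) h2).
    apply filter_imp. intros y [hl hd]. apply (is_derive_ext_loc f1); auto.
    revert hl. apply filter_imp. intros z hz. symmetry. now apply is_derive_unique. }
  assert (e2 : Derive (Derive f) a = f2 a).
  { apply is_derive_unique. now apply (locally_singleton a _ step). }
  assert (smooth : locally a (fun y => forall k, (k <= 2)%nat -> ex_derive_n f k y)).
  { generalize (filter_and _ _ h1 step). apply filter_imp. intros y [hd hd2] k hk.
    destruct k as [|[|[|k]]]; simpl; [exact I | | | lia].
    - now exists (f1 y).
    - now exists (f2 y). }
  split; intros hn.
  - split; [|split].
    + revert smooth. apply filter_imp. intros y hy k hk. apply hy. lia.
    + intros k hk. replace k with 0%nat by lia. exact h0.
    + change (Derive f a <> 0). rewrite e1. exact hn.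
  - intros hn2. split; [exact smooth|split].
    + intros k hk. destruct k as [|[|k]]; [exact h0 | | lia]. change (Derive f a = 0). now rewrite e1.
    + change (Derive (Derive f) a <> 0). rewrite e2. exact hn2.
Qed.

Section Cycle.

Variables (T : R) (h phi : R -> R).
Hypotheses (hT : 0 < T) (hphi : solution_on (fun _ => True) (riccati h) phi).
Hypothesis pphi : periodic T phi.

Let M := growth phi T.
Let S := RInt (growth phi) 0 T.

Lemma neighbour_period (y0 : R) :
  neighbour phi y0 T = phi 0 + y0 * M / (1 - y0 * S).
Proof.
  unfold neighbour. fold M S. now rewrite (periodic_end T phi pphi).
Qed.

Lemma displacement_near_cycle (y : R) :
  0 < 1 - (y - phi 0) * S ->
  displacement T (riccati h) y = (y - phi 0) * M / (1 - (y - phi 0) * S) - (y - phi 0).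
Proof.
  intros hy. pose proof (neighbour_0 phi (y - phi 0)) as e0.
  replace (phi 0 + (y - phi 0)) with y in e0 by ring.
  rewrite <- e0 at 1. rewrite riccati_displacement; auto.
  - rewrite neighbour_period, e0. ring.
  - now apply neighbour_solution_segment.
Qed.

Lemma locally_denominator_pos : locally (phi 0) (fun y => 0 < 1 - (y - phi 0) * S).
Proof.
  assert (hS : 0 < S) by now apply (growth_integral_pos h).
  assert (hp : 0 < / S) by now apply Rinv_0_lt_compat.
  exists (mkposreal _ hp). intros y hy.
  change (Rabs (y - phi 0) < / S) in hy.
  apply (Rmult_lt_compat_r S) in hy; auto. rewrite Rinv_l in hy by lra.
  pose proof (Rle_abs (y - phi 0)). nra.
Qed.

(** The displacement at [phi 0 + y0] is [M y0 / (1 - S y0) - y0]: its derivative at [y0 = 0] is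
    [M - 1], and when [M = 1] its second derivative there is [2 S], which is positive. *)
Lemma cycle_multiplicity :
  (RInt phi 0 T <> 0 -> hyperbolic T (riccati h) phi) /\
  (RInt phi 0 T = 0 -> double_cycle T (riccati h) phi).
Proof.
  assert (hS : 0 < S) by now apply (growth_integral_pos h).
  assert (defined : locally (phi 0) (fun y => exists d, is_displacement T (riccati h) y d)).
  { generalize locally_denominator_pos. apply filter_imp. intros y hy.
    exists (neighbour phi (y - phi 0) T - y), (neighbour phi (y - phi 0)). split; [|split].
    - now apply neighbour_solution_segment.
    - rewrite neighbour_0. ring.
    - reflexivity. }
  set (d1 := fun y => M / (1 - (y - phi 0) * S) ^ 2 - 1).
  destruct (multiplicity_of_derivatives (displacement T (riccati h)) d1
    (fun y => 2 * M * S / (1 - (y - phi 0) * S) ^ 3) (phi 0)) as [simple double].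
  - generalize (locally_locally _ _ locally_denominator_pos).
    apply filter_imp. intros y hy.
    apply (is_derive_ext_loc
      (fun y => (y - phi 0) * M / (1 - (y - phi 0) * S) - (y - phi 0))).
    + revert hy. apply filter_imp. intros z hz. symmetry. now apply displacement_near_cycle.
    + apply locally_singleton in hy. auto_derive; [lra|]. unfold d1. field. lra.
  - generalize locally_denominator_pos. apply filter_imp. intros y hy. unfold d1.
    auto_derive; [nra|]. field. lra.
  - rewrite displacement_near_cycle; rewrite Rminus_diag; [field|]; lra.
  - assert (e1 : d1 (phi 0) = M - 1) by (unfold d1; rewrite Rminus_diag; field).
    split; intros hz; (split; [exact defined|]).
    + apply simple. rewrite e1. intros hM. apply hz, growth_eq_1. fold M. lra.
    + apply growth_eq_1 in hz. fold M in hz. apply double.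
      * rewrite e1. lra.
      * rewrite Rminus_diag, hz. replace (2 * 1 * S / (1 - 0 * S) ^ 3) with (2 * S) by field. lra.
Qed.

(** * A cycle of zero mean is semi-stable and unique *)

Section SemiStable.

Hypothesis zphi : RInt phi 0 T = 0.

(** As [phi] has zero mean, its primitive is periodic, hence bounded. *)
Lemma growth_bounds :
  exists m b, 0 < m /\ forall t, m <= growth phi t <= b.
Proof.
  set (a := RInt phi 0).
  assert (da : forall t, is_derive a t (phi t)).
  { intros t. apply is_derive_primitive. intros s. apply (solution_continuous _ _ hphi). }
  assert (pa : periodic T a).
  { intros t.
    assert (e : a (t + T) - a t = a (0 + T) - a 0).
    { apply (constant_of_derive_0 (fun t => a (t + T) - a t)). intros s.
      eapply is_derive_eq.
      - apply (is_derive_minus (fun t => a (t + T)) a); [|apply da].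
        apply (is_derive_comp a (fun t => t + T)); [apply da|]. auto_derive; auto.
      - rewrite pphi. unfold minus, plus, opp, scal; simpl. unfold mult; simpl. ring. }
    rewrite Rplus_0_l in e. unfold a in e at 3 4. rewrite zphi, RInt_0_0 in e. lra. }
  destruct (periodic_bounded T a hT pa) as [C [hC0 hC]].
  { intros t. apply (is_derive_continuous a t (phi t)), da. }
  exists (exp (-2 * C)), (exp (2 * C)). split; [apply exp_pos|]. intros t.
  specialize (hC t). apply Rabs_le_between in hC. unfold growth. fold a.
  split; apply Rnot_lt_le; intros hlt; apply exp_lt_inv in hlt; lra.
Qed.

(** Hence the denominator of [neighbour] grows at least linearly in the time direction where
    it increases, and the solution converges to [phi] there. *)
Lemma growth_integral_linear (m : R) :
  (forall t, m <= growth phi t) ->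
  forall t, (0 <= t -> m * t <= RInt (growth phi) 0 t) /\
            (t <= 0 -> RInt (growth phi) 0 t <= m * t).
Proof.
  intros hm t.
  assert (d : forall s, is_derive (fun s => RInt (growth phi) 0 s - m * s) s (growth phi s - m)).
  { intros s. apply (is_derive_minus (RInt (growth phi) 0) (fun s => m * s)).
    - apply (is_derive_growth_integral _ _ hphi).
    - auto_derive; auto. ring. }
  split; intros ht.
  - pose proof (nondecreasing _ _ 0 t ht (fun s _ => d s)) as mono. simpl in mono.
    rewrite RInt_0_0 in mono. enough (0 - m * 0 <= RInt (growth phi) 0 t - m * t) by lra.
    apply mono. intros s _. specialize (hm s). lra.
  - pose proof (nondecreasing _ _ t 0 ht (fun s _ => d s)) as mono. simpl in mono.
    rewrite RInt_0_0 in mono. enough (RInt (growth phi) 0 t - m * t <= 0 - m * 0) by lra.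
    apply mono. intros s _. specialize (hm s). lra.
Qed.

Lemma quotient_small (m b y k s F eps : R) :
  0 < m -> 0 < y -> 0 < eps -> 0 < F <= b -> 0 <= s -> b / (eps * m) < s ->
  1 + y * (m * s) <= k -> Rabs (y * F / k) < eps.
Proof.
  intros hm hy he hF hs hbs hk.
  assert (hem : 0 < eps * m) by nra.
  apply (Rmult_lt_compat_r (eps * m)) in hbs; auto.
  replace (b / (eps * m) * (eps * m)) with b in hbs by (field; lra).
  assert (0 <= y * (m * s)) by (apply Rmult_le_pos; nra).
  assert (0 < y * F / k) by (apply Rdiv_lt_0_compat; nra).
  rewrite Rabs_pos_eq by lra. apply (Rmult_lt_reg_r k); [lra|].
  replace (y * F / k * k) with (y * F) by (field; lra).
  assert (y * F <= y * b) by nra. assert (y * b < y * (s * (eps * m))) by nra. nra.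
Qed.

Lemma zero_mean_attracts_below : attracts (riccati h) phi (-1).
Proof.
  destruct growth_bounds as [m [b [hm hb]]].
  pose proof (growth_integral_linear m (fun t => proj1 (hb t))) as lin.
  exists 1. split; [lra|]. intros y hy. exists (neighbour phi (-1 * y)).
  assert (pos : forall t, 0 <= t -> 1 + y * (m * t) <= 1 - -1 * y * RInt (growth phi) 0 t).
  { intros t ht. pose proof (proj1 (lin t) ht). nra. }
  split; [|split].
  - intros t ht. apply neighbour_solution; auto. specialize (pos t ht).
    assert (0 <= y * (m * t)) by (apply Rmult_le_pos; nra). lra.
  - apply neighbour_0.
  - apply is_lim_spec. intros eps. exists (Rmax 0 (b / (eps * m))). intros t ht.
    assert (0 < t) by (eapply Rle_lt_trans; [apply Rmax_l | exact ht]).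
    assert (b / (eps * m) < t) by (eapply Rle_lt_trans; [apply Rmax_r | exact ht]).
    unfold neighbour.
    replace (phi t + -1 * y * growth phi t / (1 - -1 * y * RInt (growth phi) 0 t) - phi t - 0)
      with (- (y * growth phi t / (1 - -1 * y * RInt (growth phi) 0 t))) by (unfold Rdiv; ring).
    rewrite Rabs_Ropp. apply (quotient_small m b y _ t); auto; try lra.
    + apply cond_pos.
    + split; [apply growth_pos | apply hb].
    + apply pos. lra.
Qed.

Lemma zero_mean_repels_above : repels (riccati h) phi 1.
Proof.
  destruct growth_bounds as [m [b [hm hb]]].
  pose proof (growth_integral_linear m (fun t => proj1 (hb t))) as lin.
  exists 1. split; [lra|]. intros y hy. exists (neighbour phi (1 * y)).
  assert (pos : forall t, t <= 0 -> 1 + y * (m * - t) <= 1 - 1 * y * RInt (growth phi) 0 t).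
  { intros t ht. pose proof (proj2 (lin t) ht). nra. }
  split; [|split].
  - intros t ht. apply neighbour_solution; auto. specialize (pos t ht).
    assert (0 <= y * (m * - t)) by (apply Rmult_le_pos; nra). lra.
  - apply neighbour_0.
  - apply is_lim_spec. intros eps. exists (- Rmax 0 (b / (eps * m))). intros t ht.
    assert (ht' : Rmax 0 (b / (eps * m)) < - t) by lra.
    assert (0 < - t) by (eapply Rle_lt_trans; [apply Rmax_l | exact ht']).
    assert (b / (eps * m) < - t) by (eapply Rle_lt_trans; [apply Rmax_r | exact ht']).
    unfold neighbour.
    replace (phi t + 1 * y * growth phi t / (1 - 1 * y * RInt (growth phi) 0 t) - phi t - 0)
      with (y * growth phi t / (1 - 1 * y * RInt (growth phi) 0 t)) by (unfold Rdiv; ring).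
    apply (quotient_small m b y _ (- t)); auto; try lra.
    + apply cond_pos.
    + split; [apply growth_pos | apply hb].
    + apply pos. lra.
Qed.

Lemma zero_mean_unique (x : R -> R) : periodic_solution T (riccati h) x -> x = phi.
Proof.
  intros hx. destruct (Req_dec (x 0) (phi 0)) as [e | ne].
  - destruct hx as [hx _]. now apply (solution_eq h).
  - pose proof (second_periodic_solution h phi hphi T x pphi hx ne) as e.
    rewrite (proj2 (growth_eq_1 phi T) zphi) in e. exfalso.
    pose proof (growth_integral_pos _ _ hphi T hT).
    assert (e' : (x 0 - phi 0) * RInt (growth phi) 0 T = 0) by lra.
    apply Rmult_integral in e'. destruct e'; lra.
Qed.

End SemiStable.

(** * The second cycle of a cycle of nonzero mean *)

Lemma second_cycle :
  (forall t, continuous h t) -> periodic T h -> RInt phi 0 T <> 0 ->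
  exists psi, periodic_solution T (riccati h) psi /\ psi 0 <> phi 0 /\
    forall x, periodic_solution T (riccati h) x -> x = phi \/ x = psi.
Proof.
  intros hc ph nz.
  assert (hS : 0 < S) by now apply (growth_integral_pos h).
  assert (hM : 0 < M) by apply growth_pos.
  assert (hM1 : M <> 1) by (intros e; apply nz, growth_eq_1, e).
  (* the nonzero fixed point of the Moebius map [y0 |-> M y0 / (1 - S y0)] *)
  set (y0 := (1 - M) / S).
  assert (e : 1 - y0 * S = M) by (unfold y0; field; lra).
  destruct (periodic_solution_of_segment T h (neighbour phi y0)) as [psi [hpsi e0]]; auto.
  - apply neighbour_solution_segment; auto. fold S. lra.
  - rewrite neighbour_period, neighbour_0, e. field. lra.
  - rewrite neighbour_0 in e0.
    assert (hy0 : y0 <> 0).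
    { intros e'. rewrite e' in e. lra. }
    exists psi. split; auto. split; [lra|].
    intros x hx. destruct (Req_dec (x 0) (phi 0)) as [ex | nx].
    + left. destruct hx as [hx _]. now apply (solution_eq h).
    + right. destruct hpsi as [hpsi _]. apply (solution_eq h); auto; [apply hx|].
      pose proof (second_periodic_solution h phi hphi T x pphi hx nx) as ey.
      fold S M in ey. rewrite e0. apply (Rmult_eq_reg_r S); lra.
Qed.

End Cycle.

(** * The trichotomy *)

Theorem theorem3 (T : R) (gamma : R -> R) (hT : 0 < T) (hgamma : C1T T gamma) :
  (0 < discriminant T gamma ->
     exists phi psi,
       phi <> psi /\
       (forall x, limit_cycle T (riccati gamma) x <-> x = phi \/ x = psi) /\
       hyperbolic T (riccati gamma) phi /\ hyperbolic T (riccati gamma) psi) /\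
  (discriminant T gamma = 0 ->
     exists phi,
       (forall x, limit_cycle T (riccati gamma) x <-> x = phi) /\
       semi_stable (riccati gamma) phi /\ double_cycle T (riccati gamma) phi) /\
  (discriminant T gamma < 0 ->
     forall x, ~ limit_cycle T (riccati gamma) x) /\
  (forall p q, C1T T p -> C1T0 T q ->
     mu_lower T gamma p - average T gamma <= discriminant T gamma /\
     discriminant T gamma <= mu_upper T gamma q - average T gamma).
Proof.
  destruct hgamma as [pg hg].
  assert (cg : forall t, continuous gamma t).
  { intros t. apply (@ex_derive_continuous R_AbsRing R_NormedModule), hg. }
  destruct (critical_parameter T gamma hT cg pg) as [phi [c [[hphi pphi] zphi]]].
  rewrite (discriminant_critical T c gamma phi); auto.
  split; [|split; [|split]].
  - intros hc.
    (* [phi' = phi ^ 2 + gamma + c] exceeds [phi ^ 2 + gamma]: [phi] is a subsolution. *)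
    destruct (periodic_solution_of_subsolution T gamma phi
      (fun t => riccati (fun t => gamma t + c) t (phi t))) as [x1 [hx1 px1]]; auto.
    { intros t. unfold riccati. lra. }
    (* A periodic solution of zero mean would make [0] critical, but [phi] reaches level [c]. *)
    assert (nz : forall x, periodic_solution T (riccati gamma) x -> RInt x 0 T <> 0).
    { intros x [hx px] z. assert (c <= 0); [|lra].
      apply (subsolution_level T 0 gamma x hT) with (p := phi)
        (dp := fun t => riccati (fun t => gamma t + c) t (phi t)); auto.
      - intros t _. unfold riccati. rewrite Rplus_0_r. apply (hx t I).
      - now apply periodic_end.
      - intros t _. unfold riccati. lra. }
    destruct (second_cycle T gamma x1) as [x2 [[hx2 px2] [ne only]]]; auto.
    { apply nz. now split. }
    exists x1, x2. split; [|split; [|split]].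
    + intros e. apply ne. now rewrite e.
    + intros x. split; [intros [hx _]; auto|].
      intros [-> | ->].
      * apply limit_cycle_intro with x2; auto. now split.
      * apply limit_cycle_intro with x1; auto; [now split|].
        intros x hx. destruct (only x hx); auto.
    + apply cycle_multiplicity; auto. apply nz. now split.
    + apply cycle_multiplicity; auto. apply nz. now split.
  - intros ->.
    assert (hphi0 : solution_on (fun _ => True) (riccati gamma) phi).
    { intros t _. specialize (hphi t I). unfold riccati in hphi.
      now rewrite Rplus_0_r in hphi. }
    exists phi. split; [|split].
    + intros x. split.
      * intros [hx _]. now apply (zero_mean_unique T gamma).
      * intros ->. split; [now split|]. exists 1. split; [lra|].
        intros x hx _. now apply (zero_mean_unique T gamma).
    + right. split.
      * now apply (zero_mean_attracts_below T).
      * now apply (zero_mean_repels_above T).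
    + now apply cycle_multiplicity.
  - intros hc x [[hx px] _]. assert (0 <= c); [|lra].
    apply (subsolution_level T c gamma phi hT) with (p := x)
      (dp := fun t => riccati gamma t (x t)); auto.
    + now apply periodic_end.
    + intros t _. unfold riccati. lra.
  - intros p q hp hq. split.
    + pose proof (mu_lower_le T c gamma phi hT cg hphi pphi zphi p hp). lra.
    + pose proof (mu_upper_ge T c gamma phi hT cg hphi pphi q hq). lra.
Qed.
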